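(* Let $F$ be an alternating shape with $n$ pipes and let $\omega\in\mathfrak S_n$ be sortable on $F$. Define the relation $\equiv_{F,\omega}$ on the weak order interval $[\mathrm{id},\omega]$ by $\pi\equiv_{F,\omega}\pi'$ iff there is $P\in\Sigma_F(\omega)$ with $\pi,\pi'\in\operatorname{lin}(P)$. Then $\equiv_{F,\omega}$ is a lattice congruence of the lattice $[\mathrm{id},\omega]$ (with the weak order), i.e. an equivalence relation such that $x\equiv x'$ and $y\equiv y'$ imply $x\wedge y\equiv x'\wedge y'$ and $x\vee y\equiv x'\vee y'$.
   Context: Grid cells are unit squares with corners in $\mathbb Z^2$, indexed by their lower-left corner. An alternating shape $F$ (with parameter $n\ge 2$) is a connected finite set of cells whose boundary splits into four paths: a starting path from $(0,0)$ made of $n$ unit steps, each south or east; a NW stair path from $(0,0)$ to $(t_F,t_F)$ with steps $(NE)^{t_F}$, $t_F\ge 0$; an ending path from $(t_F,t_F)$ made of $n$ unit steps, each south or east; and a SE stair path from the endpoint of the starting path to the endpoint of the ending path with steps $(EN)^{b}$, $b\ge0$; the ending path stays strictly north and east of the starting path. A pipe dream on $F$ fills each cell with either a cross (one pipe passing straight horizontally, one straight vertically) or a contact (one elbow joining the west side to the north side, called the NW elbow, and one joining the south side to the east side, called the SE elbow), so that the $n$ pipes entering through the $n$ unit steps of the starting path exit through the $n$ unit steps of the ending path. Pipes are labelled $1,\dots,n$ by their entry step, from northwest to southeast along the starting path; the exit permutation $\omega$ is given by: $\omega(i)$ is the pipe exiting through the $i$-th step of the ending path (counted from northwest to southeast).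 A pipe dream is reduced if any two pipes cross at most once. $\Pi_F(\omega)$ is the set of reduced pipe dreams on $F$ with exit permutation $\omega$; $\omega$ is sortable on $F$ if $\Pi_F(\omega)\neq\emptyset$. For $a<b$, $(a,b)$ is an inversion of $\omega$ if $\omega^{-1}(b)<\omega^{-1}(a)$ and a noninversion otherwise; the (right) weak order is $\omega_1\le\omega_2$ iff the inversion set of $\omega_1$ is contained in that of $\omega_2$. The contact graph of $P$ is the directed graph on $\{1,\dots,n\}$ with an arc $a\to b$ iff some contact cell of $P$ has pipe $a$ on its NW elbow and pipe $b$ on its SE elbow. The extended contact graph is obtained by adding all arcs $a\to b$ with $(a,b)$ a noninversion of $\omega$. $P$ is strongly acyclic if its extended contact graph is acyclic. $\Sigma_F(\omega)$ is the set of strongly acyclic pipe dreams in $\Pi_F(\omega)$. For $P\in\Sigma_F(\omega)$, $\operatorname{lin}(P)$ is the set of permutations $\pi$ with $\pi^{-1}(a)<\pi^{-1}(b)$ for every arc $a\to b$ of the extended contact graph of $P$. *)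

(* Defs.v *)
From HB Require Import structures.
From mathcomp Require Import all_boot all_order all_algebra all_fingroup finmap.
From Stdlib Require Import Relation_Operators.

Set Implicit Arguments.
Unset Strict Implicit.
Unset Printing Implicit Defensive.

Import Order.TTheory GRing.Theory Num.Theory.

Local Open Scope ring_scope.

(* A cell is denoted by its lower-left corner, hence is also a point. *)
Definition point : Type := (int * int)%type.
Definition origin : point := (0, 0).
Definition east_of (p : point) : point := (p.1 + 1, p.2).
Definition north_of (p : point) : point := (p.1, p.2 + 1).
Definition west_of (p : point) : point := (p.1 - 1, p.2).
Definition south_of (p : point) : point := (p.1, p.2 - 1).

(* Unit edges are unoriented: [hedge p] joins p to p + (1,0) and [vedge p]
   joins p to p + (0,1). *)
Definition edge : Type := (bool * point)%type.
Definition hedge (p : point) : edge := (true, p).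
Definition vedge (p : point) : edge := (false, p).

Definition west_side (c : point) : edge := vedge c.
Definition south_side (c : point) : edge := hedge c.
Definition east_side (c : point) : edge := vedge (east_of c).
Definition north_side (c : point) : edge := hedge (north_of c).
Definition sides (c : point) : seq edge :=
  [:: west_side c; south_side c; east_side c; north_side c].

Inductive dir := North | South | East.

Definition is_SE (d : dir) : bool := if d is North then false else true.

Definition move (p : point) (d : dir) : point :=
  match d with
  | North => north_of p
  | South => south_of p
  | East => east_of p
  end.

Definition step_edge (p : point) (d : dir) : edge :=
  match d with
  | North => vedge p
  | South => vedge (south_of p)
  | East => hedge p
  end.

Definition vertex (p : point) (w : seq dir) (i : nat) : point :=
  foldl move p (take i w).

Definition endpoint (p : point) (w : seq dir) : point := foldl move p w.

Fixpoint path_edges (p : point) (w : seq dir) : seq edge :=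
  if w is d :: w' then step_edge p d :: path_edges (move p d) w' else [::].

Definition NE_stair (k : nat) : seq dir := flatten (nseq k [:: North; East]).
Definition EN_stair (k : nat) : seq dir := flatten (nseq k [:: East; North]).

(* An edge is on the boundary when exactly one of its two cells is in C. *)
Definition boundary (C : {fset point}) (e : edge) : bool :=
  (e.2 \in C) (+) ((if e.1 then south_of e.2 else west_of e.2) \in C).

Definition connected_cells (C : {fset point}) : Prop :=
  forall c d : C,
    connect (fun u v : C => has (mem (sides (val u))) (sides (val v))) c d.

(* The i-th vertices of the starting and ending paths lie on the same diagonal
   y - x = -i, and strictness is required for the interior vertices only: the
   initial (resp. final) vertices are t_F (resp. b) diagonal steps apart, and
   both t_F and b may vanish. *)
Record alternating_shape (n : nat) := AlternatingShape {
  cells :> {fset point};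
  start_path : n.-tuple dir;
  end_path : n.-tuple dir;
  nw_size : nat;
  se_size : nat;
  shape_connected : connected_cells cells;
  start_path_SE : all is_SE start_path;
  end_path_SE : all is_SE end_path;
  shape_closed :
    endpoint (endpoint origin start_path) (EN_stair se_size)
    = endpoint (endpoint origin (NE_stair nw_size)) end_path;
  end_path_above : forall i : nat, (0 < i < n)%N ->
    let s := vertex origin start_path i in
    let e := vertex (endpoint origin (NE_stair nw_size)) end_path i in
    (s.1 < e.1) && (s.2 < e.2);
  shape_boundary : forall e : edge, boundary cells e =
    (e \in path_edges origin start_path
        ++ path_edges origin (NE_stair nw_size)
        ++ path_edges (endpoint origin (NE_stair nw_size)) end_path
        ++ path_edges (endpoint origin start_path) (EN_stair se_size))
}.

Inductive tile := Cross | Contact.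

Section PipeDreams.

Variables (n : nat) (F : alternating_shape n).

Implicit Types (i j a b : 'I_n) (w p : 'S_n).

Definition entry_edge i : edge :=
  step_edge (vertex origin (start_path F) i) (tnth (start_path F) i).

Definition exit_edge i : edge :=
  step_edge (vertex (endpoint origin (NE_stair (nw_size F))) (end_path F) i)
            (tnth (end_path F) i).

Definition filling : Type := {ffun F -> tile}.

Implicit Types (P : filling) (c d : F).

(* Pipes travel north and east, so they enter a cell from its west or south
   side and leave it through its east or north side. *)
Definition flow P (e e' : edge) : Prop :=
  exists c,
    match P c with
    | Cross => (e = west_side (val c) /\ e' = east_side (val c))
            \/ (e = south_side (val c) /\ e' = north_side (val c))
    | Contact => (e = west_side (val c) /\ e' = north_side (val c))
              \/ (e = south_side (val c) /\ e' = east_side (val c))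
    end.

(* Labels are 0-based: pipe i enters through step i of the starting path. *)
Definition on_pipe P i (e : edge) : Prop :=
  clos_refl_trans edge (flow P) (entry_edge i) e.

Definition exit_permutation P w : Prop :=
  forall i, on_pipe P (w i) (exit_edge i).

Definition cross_at P a b c : Prop :=
  P c = Cross /\
  ((on_pipe P a (west_side (val c)) /\ on_pipe P b (south_side (val c)))
   \/ (on_pipe P b (west_side (val c)) /\ on_pipe P a (south_side (val c)))).

Definition reduced P : Prop :=
  forall a b, a <> b -> forall c d, cross_at P a b c -> cross_at P a b d -> c = d.

(* The set Pi_F(w). *)
Definition reduced_pipe_dream w P : Prop := exit_permutation P w /\ reduced P.

Definition sortable w : Prop := exists P, reduced_pipe_dream w P.

Definition inversion w a b : bool := (a < b)%N && ((w^-1)%g b < (w^-1)%g a)%N.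

Definition noninversion w a b : bool := (a < b)%N && ~~ inversion w a b.

Definition contact_arc P a b : Prop :=
  exists c, [/\ P c = Contact, on_pipe P a (west_side (val c))
              & on_pipe P b (south_side (val c))].

Definition extended_arc w P a b : Prop :=
  contact_arc P a b \/ noninversion w a b.

Definition strongly_acyclic w P : Prop :=
  forall a, ~ clos_trans 'I_n (extended_arc w P) a a.

(* The set Sigma_F(w). *)
Definition acyclic_pipe_dream w P : Prop :=
  reduced_pipe_dream w P /\ strongly_acyclic w P.

Definition lin w P p : Prop :=
  forall a b, extended_arc w P a b -> ((p^-1)%g a < (p^-1)%g b)%N.

Definition pipe_equiv w p p' : Prop :=
  exists P, [/\ acyclic_pipe_dream w P, lin w P p & lin w P p'].

End PipeDreams.

Definition weak_le (n : nat) (w1 w2 : 'S_n) : bool :=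
  [forall a, forall b, inversion w1 a b ==> inversion w2 a b].

Definition weak_interval (n : nat) (w1 w2 : 'S_n) : pred 'S_n :=
  [pred p | weak_le w1 p && weak_le p w2].

Section LatticeCongruence.

Variables (T : Type) (D : pred T) (le : rel T).

Definition is_meet (x y m : T) : Prop :=
  [/\ m \in D, le m x, le m y
    & forall z, z \in D -> le z x -> le z y -> le z m].

Definition is_join (x y m : T) : Prop :=
  [/\ m \in D, le x m, le y m
    & forall z, z \in D -> le x z -> le y z -> le m z].

Definition is_lattice : Prop :=
  [/\ {in D, reflexive le}, {in D &, antisymmetric le},
      {in D & &, transitive le},
      {in D &, forall x y, exists m, is_meet x y m}
    & {in D &, forall x y, exists m, is_join x y m}].

Definition equivalence_on (R : T -> T -> Prop) : Prop :=
  [/\ {in D, forall x, R x x}, {in D &, forall x y, R x y -> R y x}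
    & {in D & &, forall x y z, R x y -> R y z -> R x z}].

Definition compatible_on (op : T -> T -> T -> Prop) (R : T -> T -> Prop) : Prop :=
  forall x x' y y' m m',
    x \in D -> x' \in D -> y \in D -> y' \in D -> R x x' -> R y y' ->
    op x y m -> op x' y' m' -> R m m'.

(* Meets and joins are given by their universal properties, so the statement
   that they exist is part of the definition. *)
Definition lattice_congruence (R : T -> T -> Prop) : Prop :=
  [/\ is_lattice, equivalence_on R, compatible_on is_meet R
    & compatible_on is_join R].

End LatticeCongruence.

(* Main.v *)
Require Import Defs.
From mathcomp Require Import all_boot all_order all_algebra all_fingroup finmap zify.
From Stdlib Require Import Classical Relation_Operators.
From Stdlib Require Operators_Properties.

(* Proof idea. Cell (x, y) acts at time x + y on the two consecutive positions
   x - y and x - y + 1 of a word of pipes, so that a filling becomes a sorting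
   network. For each pi below omega there is exactly one pipe dream P with pi in
   lin(P): for the identity, cross every pair as late as possible; then follow
   adjacent transpositions, exchanging the first contact of the two pipes with
   their crossing if they have a contact, and changing nothing otherwise. Thus
   the relation is the equality of these pipe dreams. As the linear extensions of
   an acyclic graph are connected by adjacent transpositions, it suffices for the
   congruence to examine two covers of a common element. This is immediate for
   commuting transpositions. For a hexagon with consecutive monotone entries
   u, b, v it follows from the absence of contacts between u and v: a pipe b
   passing beside such a contact contains an elbow facing it, and the rectangle
   between two contacts of a reduced pipe dream yields a path of contacts, so
   that b would precede u or follow v. *)

(** Exchanging a crossing and a contact of two pipes only interchanges their trajectories between
    the two cells, so every other contact survives up to renaming these two labels. Hence the
    absence of contacts can be carried along an adjacent transposition. Two permutations that differ
    by exchanging consecutive entries share a pipe dream exactly when these entries have no contact.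
    In the hexagon, if [u] and [b] have no contact, then neither do [u] and [v], and exchanging [b]
    and [v] merely permutes these two absences: one pipe dream serves the whole opposite side.
    Acyclicity need not be tracked, since any element of lin(P) certifies it. Sortability only
    provides some reduced pipe dream, possibly with a cyclic graph; delaying its crossings repairs
    this for the identity. Uniqueness for the identity is read backwards in time, because the exits
    are prescribed. That the interval is a lattice comes from the same polygons: joins of two covers
    of a common element generate all joins. Meets are joins for the dual order, so a Boolean selects
    the order throughout the study of covers. *)

Set Implicit Arguments.
Unset Strict Implicit.
Unset Printing Implicit Defensive.

(** * Trajectories of pipes *)

(* The cell [(x, y)] is indexed by [k = x - y] and by the time [j = x + y] (up to
   a shift); it acts on the pipes of level [k], entering from the west, and
   [k.+1], entering from the south. [lo k] and [hi k] are the times of the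
   [k]-th vertices of the starting and ending paths. *)
Record net := Net {
  width : nat;
  offset : nat;
  horizon : nat;
  lo : nat -> nat;
  hi : nat -> nat;
  lo_step : forall k, k < width -> lo k.+1 = (lo k).+1 \/ lo k = (lo k.+1).+1;
  hi_step : forall k, k < width -> hi k.+1 = (hi k).+1 \/ hi k = (hi k.+1).+1;
  lo_odd : forall k, k <= width -> ~~ odd (k + lo k + offset);
  hi_odd : forall k, k <= width -> ~~ odd (k + hi k + offset);
  lo_hi : forall k, k <= width -> lo k <= hi k;
  hi_horizon : forall k, k <= width -> hi k <= horizon }.

Section Net.

Variable N : net.
Local Notation n := (width N).
Local Notation M := (horizon N).

Definition cell (k j : nat) : bool :=
  [&& k <= n, ~~ odd (k + j + offset N), lo N k <= j & j < hi N k].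

Lemma lo_lip k l : k <= l <= n -> (lo N k <= lo N l + (l - k)) /\ (lo N l <= lo N k + (l - k)).
Proof.
elim: l => [|l IH] H; first by move: H; rewrite leqn0 andbT => /eqP->; lia.
have [->|kl] := eqVneq k l.+1; first lia.
have := IH ltac:(lia); have := @lo_step N l; lia.
Qed.

Lemma hi_lip k l : k <= l <= n -> (hi N k <= hi N l + (l - k)) /\ (hi N l <= hi N k + (l - k)).
Proof.
elim: l => [|l IH] H; first by move: H; rewrite leqn0 andbT => /eqP->; lia.
have [->|kl] := eqVneq k l.+1; first lia.
have := IH ltac:(lia); have := @hi_step N l; lia.
Qed.

(* In grid coordinates [x = (j + k) / 2] and [y = (j - k) / 2], the cells
   [(k1, j1)] and [(k2, j2)] lie weakly southwest and northeast of [(k, j)]. *)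
Lemma cell_convex k1 j1 k2 j2 k j : cell k1 j1 -> cell k2 j2 ->
    ~~ odd (k + j + offset N) -> k <= n ->
    k1 + j1 <= k + j -> j1 + k <= j + k1 -> k + j <= k2 + j2 -> j + k2 <= j2 + k ->
  cell k j.
Proof.
move=> /and4P[a1 a2 a3 a4] /and4P[b1 b2 b3 b4] e kn h1 h2 h3 h4.
apply/and4P; split=> //.
  have [kk|kk] := leqP k1 k; [have := @lo_lip k1 k | have := @lo_lip k k1]; lia.
have [kk|kk] := leqP k2 k; [have := @hi_lip k2 k | have := @hi_lip k k2]; lia.
Qed.

Section Tiling.

Variable X : nat -> nat -> bool.

(** Cells with [k = 0] or [k = n] lie along the stairs and are visited by a single pipe, so nothing
    can be exchanged there. Values of [X] outside the cells are ignored. *)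
Definition crossing (k j : nat) : bool := [&& X k j, cell k j, 0 < k & k < n].
Local Notation C := crossing.

Definition next_lev (j d : nat) : nat :=
  if C d j then d.+1 else if C d.-1 j then d.-1 else d.

(* Pipe [i] is given level [i.+1] until it enters and keeps its last level after
   it has left. *)
Fixpoint lev (i j : nat) : nat := if j is j'.+1 then next_lev j' (lev i j') else i.+1.

Lemma crossing_cell k j : C k j -> [/\ cell k j, 0 < k & k < n].
Proof. by case/and4P. Qed.

Lemma crossing_odd k j : C k j -> ~~ odd (k + j + offset N).
Proof. by case/and4P=> _ /and4P[]. Qed.

Lemma crossing_bound k j : C k j -> [/\ 0 < k, k < n & j < M].
Proof.
case/crossing_cell=> /and4P[a b c d] k0 kn; split=> //.
exact: leq_trans d (hi_horizon a).
Qed.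

Lemma next_levP j d : 0 < d ->
  [\/ [/\ C d j, next_lev j d = d.+1 & d < n],
      [/\ C d.-1 j, next_lev j d = d.-1, ~~ C d j & 1 < d <= n]
    | [/\ ~~ C d j, ~~ C d.-1 j & next_lev j d = d]].
Proof.
move=> d0; rewrite /next_lev.
case: ifP => c1; first by constructor 1; case/crossing_bound: (c1).
case: ifP => c2; last by constructor 3.
by constructor 2; split=> //; case/crossing_bound: (c2); lia.
Qed.

Lemma next_lev_gt0 j d : 0 < d -> 0 < next_lev j d.
Proof. by move=> d0; case: (next_levP j d0) => -[]; lia. Qed.

(** Simultaneous crossings have levels of the same parity, hence exchange disjoint pairs of levels:
    a time step is an involution. *)
Lemma next_levK j d : 0 < d -> next_lev j (next_lev j d) = d.
Proof.
move=> d0; case: (next_levP j d0) => [[c e _]|[c e c' h]|[c c' e]]; rewrite e //.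
- rewrite /next_lev; case: ifP => c2.
    by have := crossing_odd c; have := crossing_odd c2; lia.
  by rewrite /= c.
- by rewrite /next_lev c; lia.
Qed.

Lemma next_lev_inj j d d' : 0 < d -> 0 < d' -> next_lev j d = next_lev j d' -> d = d'.
Proof. by move=> d0 d0' e; rewrite -(next_levK j d0) e next_levK. Qed.

Lemma lev_gt0 i j : 0 < lev i j.
Proof. by elim: j => //= j; apply: next_lev_gt0. Qed.

Lemma lev_inj i i' j : lev i j = lev i' j -> i = i'.
Proof.
elim: j => [[]|j IH] //= /next_lev_inj e; apply: IH; apply: e; exact: lev_gt0.
Qed.

Lemma lev_surj d j : 0 < d -> exists i, lev i j = d.
Proof.
elim: j d => [|j IH] d d0; first by exists d.-1 => /=; lia.
have [i hi] := IH _ (next_lev_gt0 j d0); exists i.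
by rewrite /= hi next_levK.
Qed.

(** Crossings exchange [k] and [k.+1] with [k < n] only, so the virtual labels from [n] on, which
    make [lev] a bijection onto the positive levels, never mix with the pipes. *)
Lemma lev_le_width i j : (lev i j <= n) = (i < n).
Proof.
elim: j => //= j <-; case: (next_levP j (lev_gt0 i j)) => -[]; lia.
Qed.

Lemma levS i j :
  [\/ [/\ C (lev i j) j, lev i j.+1 = (lev i j).+1 & i < n],
      [/\ C (lev i j).-1 j, lev i j.+1 = (lev i j).-1, 1 < lev i j & i < n]
    | [/\ ~~ C (lev i j) j, ~~ C (lev i j).-1 j & lev i j.+1 = lev i j]].
Proof.
have := next_levP j (lev_gt0 i j); rewrite -(lev_le_width i j).
by case=> -[*]; [constructor 1|constructor 2|constructor 3]; split=> //; lia.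
Qed.

Lemma lev_west k j i : lev i j = k -> C k j -> lev i j.+1 = k.+1.
Proof. by move=> /= ->; rewrite /next_lev => ->. Qed.

Lemma lev_south k j i : lev i j = k.+1 -> C k j -> lev i j.+1 = k.
Proof.
move=> /= -> c; rewrite /next_lev /= c; case: ifP => // c2.
by have := crossing_odd c; have := crossing_odd c2; lia.
Qed.

Lemma lev_west_contact k j i : lev i j = k -> ~~ C k j ->
  ~~ odd (k + j + offset N) -> lev i j.+1 = k.
Proof.
move=> h c o; case: (levS i j) => -[]; rewrite h //.
- by rewrite (negbTE c).
- by move=> /crossing_odd; lia.
Qed.

Lemma lev_south_contact k j i : lev i j = k.+1 -> ~~ C k j ->
  ~~ odd (k + j + offset N) -> lev i j.+1 = k.+1.
Proof.
move=> h c o; case: (levS i j) => -[]; rewrite h //.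
- by move=> /crossing_odd; lia.
- by rewrite (negbTE c).
Qed.

Lemma lev_west_prev k j i : lev i j.+1 = k.+1 -> C k j -> lev i j = k.
Proof.
move=> h c; have o := crossing_odd c; have h0 := lev_gt0 i j.
case: (levS i j) => -[].
- by lia.
- by move=> /crossing_odd; lia.
- by move=> _ c2 e; move: c2; rewrite -e h /= c.
Qed.

Lemma lev_south_prev k j i : lev i j.+1 = k -> C k j -> lev i j = k.+1.
Proof.
move=> h c; have o := crossing_odd c; have h0 := lev_gt0 i j.
case: (levS i j) => -[].
- by move=> /crossing_odd; lia.
- by lia.
- by move=> c2 _ e; move: c2; rewrite -e h c.
Qed.

Lemma lev_contact_prev k j i : ~~ C k j -> ~~ odd (k + j + offset N) ->
  (lev i j.+1 = k -> lev i j = k) /\ (lev i j.+1 = k.+1 -> lev i j = k.+1).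
Proof.
move=> c o; have h0 := lev_gt0 i j; split=> h; case: (levS i j) => -[].
- by move=> /crossing_odd; lia.
- move=> c1 e ; have e1 : (lev i j).-1 = k by lia.
  by rewrite e1 (negbTE c) in c1.
- by lia.
- move=> c1 e; have e1 : lev i j = k by lia.
  by rewrite e1 (negbTE c) in c1.
- by move=> /crossing_odd; lia.
- by lia.
Qed.

Lemma lev_lip i j j' : j <= j' ->
  lev i j' <= lev i j + (j' - j) /\ lev i j <= lev i j' + (j' - j).
Proof.
elim: j' => [|j' IH]; first by rewrite leqn0 => /eqP->; lia.
rewrite leq_eqVlt => /orP[/eqP->|h]; first lia.
by have := IH h; case: (levS i j') => -[]; lia.
Qed.

Lemma lev_neq p q j : p <> q -> lev p j <> lev q j.
Proof. by move=> h /lev_inj. Qed.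

Lemma lev_swap p q j : lev p j < lev q j -> lev q j.+1 < lev p j.+1 ->
  C (lev p j) j /\ lev q j = (lev p j).+1.
Proof.
move=> h1 h2; have hp := lev_gt0 p j.
case: (levS p j) => [[cp ep _]|[cp ep _ _]|[cp _ ep]];
  case: (levS q j) => [[cq eq _]|[cq eq _ _]|[cq cq' eq]];
  rewrite ep eq in h2; lia.
Qed.

Lemma lev_crossing p q j j' : j <= j' -> lev p j < lev q j -> lev q j' < lev p j' ->
  exists i, [/\ j <= i < j', C (lev p i) i & lev q i = (lev p i).+1].
Proof.
move=> jj h; elim: j' jj => [|j' IH].
  by rewrite leqn0 => /eqP e; move: h; rewrite e; lia.
rewrite leq_eqVlt => /orP[/eqP<-|jj h2]; first lia.
have [h3|h3] := leqP (lev q j') (lev p j').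
  have pq : p <> q by move=> e; move: h; rewrite e; lia.
  have h4 := @lev_neq p q j' pq.
  have [|i [? ? ?]] := IH jj; first lia.
  by exists i; split=> //; lia.
by have [? ?] := lev_swap h3 h2; exists j'; split=> //; lia.
Qed.

Lemma lev_swapped p q j : C (lev p j) j -> lev q j = (lev p j).+1 ->
  lev p j.+1 = (lev p j).+1 /\ lev q j.+1 = lev p j.
Proof.
move=> c h; split; first exact: (lev_west (erefl _) c).
exact: lev_south h c.
Qed.

(* If two pipes cross twice, then at one of the crossings the larger label comes
   from the west. *)
Definition reduced_tiling : Prop :=
  forall p q j, C (lev p j) j -> lev q j = (lev p j).+1 -> p < q.

(** Undoing the inversion would require a crossing with the larger label coming from the west. *)
Lemma reduced_crossed p q j j' : reduced_tiling -> p < q -> j <= j' ->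
  lev q j < lev p j -> lev q j' < lev p j'.
Proof.
move=> red pq jj h; case: (ltngtP (lev q j') (lev p j')) => // h2.
- by have [i [_ c e]] := lev_crossing jj h h2; have := red _ _ _ c e; lia.
- by move/lev_inj: h2; lia.
Qed.

(** An arc from [p] to [q] of the contact graph: the pipe entering from the west is on the NW elbow.
    The bound on the level excludes the southeast stair, where no second pipe passes. *)
Definition contact (p q j : nat) : bool :=
  [&& lev p j < n, cell (lev p j) j, lev q j == (lev p j).+1 & ~~ C (lev p j) j].

Lemma contactE p q j k : lev p j = k -> lev q j = k.+1 -> k < n -> cell k j ->
  ~~ C k j -> contact p q j.
Proof. by move=> hp hq kn a c; rewrite /contact hp hq eqxx kn a c. Qed.

Lemma contact_width p q j : contact p q j -> p < n /\ q < n.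
Proof.
case/and4P=> h _ /eqP e _; rewrite -(lev_le_width p j) -(lev_le_width q j); lia.
Qed.

Lemma lev_fixed d j : 0 < d -> C d j = false -> C d.-1 j = false ->
  forall i, ((lev i j.+1 < d) = (lev i j < d)) * ((lev i j.+1 == d) = (lev i j == d)).
Proof.
move=> d0 c1 c2 i; have h0 := lev_gt0 i j.
case: (levS i j) => -[c e h].
- have h1 : lev i j <> d by move=> e1; rewrite e1 c1 in c.
  have h2 : lev i j <> d.-1 by move=> e1; rewrite e1 c2 in c.
  by split; lia.
- have h1 : (lev i j).-1 <> d by move=> e1; rewrite e1 c1 in c.
  have h2 : (lev i j).-1 <> d.-1 by move=> e1; rewrite e1 c2 in c.
  by split; lia.
- by rewrite h.
Qed.

(** The bound is the time of the entry step of level [d]; until then the cells of indices [d.-1] and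
    [d], the only ones that touch this level, have not started. *)
Lemma lev_before d j : 0 < d <= n -> j <= minn (lo N d.-1) (lo N d) ->
  forall i, ((lev i j < d) = (i.+1 < d)) * ((lev i j == d) = (i.+1 == d)).
Proof.
move=> dn; elim: j => [|j IH] h i; first by [].
have c1 : C d j = false by apply/negbTE/negP=> /crossing_cell[/and4P[]]; lia.
have c2 : C d.-1 j = false by apply/negbTE/negP=> /crossing_cell[/and4P[]]; lia.
have d0 : 0 < d by lia.
by split; rewrite (lev_fixed d0 c1 c2) IH //; lia.
Qed.

(** The two ends differ by one, and at the earlier of them parity already forbids a cell on the
    diagonal that ends later. *)
Lemma lev_after d j j' : 0 < d <= n -> minn (hi N d.-1) (hi N d) <= j <= j' ->
  forall i, ((lev i j' < d) = (lev i j < d)) * ((lev i j' == d) = (lev i j == d)).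
Proof.
move=> dn; elim: j' => [|j' IH] h i.
  by have ->: j = 0 by lia.
have [->//|jj] := eqVneq j j'.+1.
have hs := @hi_step N d.-1.
have o1 := @hi_odd N d; have o2 := @hi_odd N d.-1.
have c1 : C d j' = false.
  by apply/negbTE/negP=> /crossing_cell[/and4P[]]; rewrite prednK in hs *; lia.
have c2 : C d.-1 j' = false.
  by apply/negbTE/negP=> /crossing_cell[/and4P[]]; rewrite prednK in hs *; lia.
have d0 : 0 < d by lia.
by split; rewrite (lev_fixed d0 c1 c2) IH //; lia.
Qed.

Lemma first_failure (Q : pred nat) W :
  (forall i, 0 < i <= W -> Q i) \/
  exists i, [/\ 0 < i <= W, ~~ Q i & forall i', 0 < i' < i -> Q i'].
Proof.
elim: W => [|W [IH|[i [h q h2]]]]; first by left; lia.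
  have [q|q] := boolP (Q W.+1).
    left=> i h; have [->//|h2] := eqVneq i W.+1; apply: IH; lia.
  by right; exists W.+1; split=> [|//|i h]; [lia|apply: IH; lia].
by right; exists i; split=> //; lia.
Qed.

(** From the cell [(k, j)], moving [i] cells east, south, west, north leads to [(k + i, j + i)],
    [(k + i, j - i)], [(k - i, j - i)], [(k - i, j + i)]. This lemma and the next three follow a
    pipe along a run of crossings, southwards and westwards being backwards in time. *)
Lemma straight_east s k j i : lev s j.+1 = k.+1 ->
  (forall i', 0 < i' <= i -> C (k + i') (j + i')) -> lev s (j + i.+1) = k + i.+1.
Proof.
move=> h; elim: i => [|i IH] c; first by rewrite !addn1.
rewrite (addnS j) (addnS k); apply: lev_west; last by apply: c; lia.
by apply: IH => i' hi; apply: c; lia.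
Qed.

Lemma straight_south s k j i : lev s j = k.+1 -> i <= j ->
  (forall i', 0 < i' <= i -> C (k + i') (j - i')) -> lev s (j - i) = k + i.+1.
Proof.
move=> h; elim: i => [|i IH] ij c; first by rewrite subn0 addn1.
rewrite (addnS k); apply: lev_south_prev; last by apply: c; lia.
have ->: (j - i.+1).+1 = j - i by lia.
by apply: IH => [|i' hi]; [lia|apply: c; lia].
Qed.

Lemma straight_west p k j i : lev p j = k -> i <= j -> i < k ->
  (forall i', 0 < i' <= i -> C (k - i') (j - i')) -> lev p (j - i) = k - i.
Proof.
move=> h; elim: i => [|i IH] ij ik c; first by rewrite !subn0.
apply: lev_west_prev; last by apply: c; lia.
have ->: (j - i.+1).+1 = j - i by lia.
have ->: (k - i.+1).+1 = k - i by lia.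
by apply: IH => [||i' hi]; [lia|lia|apply: c; lia].
Qed.

Lemma straight_north p k j i : lev p j.+1 = k -> i < k ->
  (forall i', 0 < i' <= i -> C (k - i') (j + i')) -> lev p (j + i.+1) = k - i.
Proof.
move=> h; elim: i => [|i IH] ik c; first by rewrite addn1 subn0.
rewrite (addnS j); apply: lev_south; last by apply: c; lia.
have ->: (k - i.+1).+1 = k - i by lia.
by apply: IH => [|i' hi]; [lia|apply: c; lia].
Qed.

(** * Rectangles between two contacts *)

Section Monotone.

Variable f : nat -> nat.
Hypothesis red : reduced_tiling.
Hypothesis f_contact : forall p q j, contact p q j -> f p < f q.

(* If no side of the rectangle carried another contact, the two pipes would
   cross both at its northeast and at its southwest corner. *)
Lemma rectangle m k1 j1 k2 j2 s p :
    k2 <= k1 + m -> k1 < k2 -> k1 + j1 <= k2 + j2 -> j2 + k1 <= j1 + k2 ->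
    k2 <= k1 + j1 + j2 -> ~~ odd (k1 + j1 + offset N) -> k2 <= n ->
    (forall k j, ~~ odd (k + j + offset N) -> k1 + j1 <= k + j <= k2 + j2 ->
       j2 + k <= j + k2 -> j + k1 <= j1 + k -> cell k j) ->
    ~~ C k1 j1 -> ~~ C k2 j2 -> lev s j1 = k1.+1 -> lev p j2 = k2 ->
    ~~ odd (k2 + j2 + offset N) -> f s <= f p.
Proof.
elim/ltn_ind: m k1 j1 k2 j2 s p => m IH k1 j1 k2 j2 s p km kk u v sw o1 kn R c1 c2 hs hp o2.
(* The width and height of the rectangle with northwest corner [(k1, j1)] and southeast corner
   [(k2, j2)]. The hypothesis [k2 <= k1 + j1 + j2] says [W <= j2]: the time of the southwest corner
   is not truncated. *)
pose W := ((k2 + j2) - (k1 + j1))./2; pose H := ((j1 + k2) - (j2 + k1))./2.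
have WE : k2 + j2 = k1 + j1 + W.*2 by rewrite /W; lia.
have HE : j1 + k2 = j2 + k1 + H.*2 by rewrite /H; lia.
have hs1 : lev s j1.+1 = k1.+1 by apply: lev_south_contact hs c1 o1.
have hp1 : lev p j2.+1 = k2 by apply: lev_west_contact hp c2 o2.
have p1n : p < n by rewrite -(lev_le_width p j2) hp.
(* North side: at its first contact [s] is on the NW elbow, and the pipe [s'] on the SE elbow starts
   a smaller rectangle. If that contact is the southeast corner, then [s] is [p]. *)
case: (first_failure (fun i => C (k1 + i) (j1 + i)) W) => [cE|[i [iW ci cE]]]; last first.
  have hi : lev s (j1 + i) = k1 + i.
    have := @straight_east s k1 j1 i.-1 hs1; rewrite prednK; last lia.
    by apply=> i' h; apply: cE; lia.
  have [e|ne] := eqVneq (k1 + i) k2.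
    have e2 : j1 + i = j2 by lia.
    by rewrite e e2 -hp in hi; rewrite (lev_inj hi).
  have [s' hs'] := @lev_surj (k1 + i).+1 (j1 + i) isT.
  have f1 : f s < f s'.
    apply: (f_contact (j := j1 + i)); apply: contactE hi hs' _ _ ci; first lia.
    by apply: R; lia.
  have f2 : f s' <= f p.
    apply: (IH (m - i) _ (k1 + i) (j1 + i) k2 j2) => //; try lia.
    by move=> k j h1 h2 h3 h4; apply: R => //; lia.
  lia.
(* West side, along which [s] is followed backwards in time. *)
case: (first_failure (fun i => C (k1 + i) (j1 - i)) H) => [cS|[i [iH ci cS]]]; last first.
  have hi : lev s (j1 - i).+1 = k1 + i.
    have := @straight_south s k1 j1 i.-1 hs; rewrite prednK; last lia.
    have ->: j1 - i.-1 = (j1 - i).+1 by lia.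
    by apply=> [|i' h]; [lia|apply: cS; lia].
  have hi2 : lev s (j1 - i) = k1 + i.
    by have [h _] := @lev_contact_prev (k1 + i) (j1 - i) s ci ltac:(lia); apply: h.
  have [e|ne] := eqVneq (k1 + i) k2.
    have e2 : j1 - i = j2 by lia.
    by rewrite e e2 -hp in hi2; rewrite (lev_inj hi2).
  have [s' hs'] := @lev_surj (k1 + i).+1 (j1 - i) isT.
  have f1 : f s < f s'.
    apply: (f_contact (j := j1 - i)); apply: contactE hi2 hs' _ _ ci; first lia.
    by apply: R; lia.
  have f2 : f s' <= f p.
    apply: (IH (m - i) _ (k1 + i) (j1 - i) k2 j2) => //; try lia.
    by move=> k j h1 h2 h3 h4; apply: R => //; lia.
  lia.
(* In a degenerate rectangle the southeast corner lies on a side already known to consist of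
   crossings. *)
have [W0|W0] := posnP W.
  have := cS H ltac:(lia).
  have ->: k1 + H = k2 by lia.
  have ->: j1 - H = j2 by lia.
  by rewrite (negbTE c2).
have [H0|H0] := posnP H.
  have := cE W ltac:(lia).
  have ->: k1 + W = k2 by lia.
  have ->: j1 + W = j2 by lia.
  by rewrite (negbTE c2).
(* South side, then east side: these are followed from [p], which is now on the SE elbow of the
   contact found, so the smaller rectangle ends at the pipe [p'] on its NW elbow. *)
case: (first_failure (fun i => C (k2 - i) (j2 - i)) W) => [cW|[i [iW ci cW]]]; last first.
  have hi : lev p (j2 - i).+1 = (k2 - i).+1.
    have := @straight_west p k2 j2 i.-1 hp.
    have ->: j2 - i.-1 = (j2 - i).+1 by lia.
    have ->: k2 - i.-1 = (k2 - i).+1 by lia.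
    by apply=> [||i' h]; [lia|lia|apply: cW; lia].
  have hi2 : lev p (j2 - i) = (k2 - i).+1.
    by have [_ h] := @lev_contact_prev (k2 - i) (j2 - i) p ci ltac:(lia); apply: h.
  have [p' hp'] := @lev_surj (k2 - i) (j2 - i) ltac:(lia).
  have f1 : f p' < f p.
    apply: (f_contact (j := j2 - i)); apply: contactE hp' hi2 _ _ ci; first lia.
    by apply: R; lia.
  have f2 : f s <= f p'.
    apply: (IH (m - i) _ k1 j1 (k2 - i) (j2 - i)) => //; try lia.
    by move=> k j h1 h2 h3 h4; apply: R => //; lia.
  lia.
case: (first_failure (fun i => C (k2 - i) (j2 + i)) H) => [cN|[i [iH ci cN]]]; last first.
  have hi : lev p (j2 + i) = (k2 - i).+1.
    have := @straight_north p k2 j2 i.-1 hp1; rewrite prednK; last lia.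
    have ->: k2 - i.-1 = (k2 - i).+1 by lia.
    by apply=> [|i' h]; [lia|apply: cN; lia].
  have [p' hp'] := @lev_surj (k2 - i) (j2 + i) ltac:(lia).
  have f1 : f p' < f p.
    apply: (f_contact (j := j2 + i)); apply: contactE hp' hi _ _ ci; first lia.
    by apply: R; lia.
  have f2 : f s <= f p'.
    apply: (IH (m - i) _ k1 j1 (k2 - i) (j2 + i)) => //; try lia.
    by move=> k j h1 h2 h3 h4; apply: R => //; lia.
  lia.
have sp : s < p.
  apply: (red (j := j1 + W)).
    have := @straight_east s k1 j1 W.-1 hs1; rewrite prednK; last lia.
    move=> ->; first by apply: cE; lia.
    by move=> i' h; apply: cE; lia.
  have := @straight_east s k1 j1 W.-1 hs1; rewrite prednK; last lia.
  move=> -> => [|i' h]; last by apply: cE; lia.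
  have := @straight_north p k2 j2 H.-1 hp1; rewrite prednK; last lia.
  have ->: j2 + H = j1 + W by lia.
  move=> -> => [||i' h]; [lia|lia|apply: cN; lia].
have ps : p < s.
  have hp2 : lev p (j2 - W) = k2 - W.
    by apply: straight_west hp _ _ cW; lia.
  apply: (red (j := j2 - W)); rewrite hp2; first by apply: cW; lia.
  have ->: j2 - W = j1 - H by lia.
  by rewrite (straight_south hs) //; lia.
lia.
Qed.

End Monotone.

End Tiling.

End Net.

(** * Contacts between non-adjacent pipes *)

Lemma change_point (Q : pred nat) i j : i <= j -> ~~ Q i -> Q j ->
  exists m, [/\ i <= m < j, ~~ Q m & Q m.+1].
Proof.
elim: j => [|j IH]; first by rewrite leqn0 => /eqP-> /negbTE->.
rewrite leq_eqVlt => /orP[/eqP<- /negbTE->//|ij] qi qj.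
have [q|q] := boolP (Q j); last by exists j; split=> //; lia.
by have [m [*]] := IH ij qi q; exists m; split=> //; lia.
Qed.

Section Contacts.

Variables (N : net) (X : nat -> nat -> bool) (f : nat -> nat).
Local Notation n := (width N).
Local Notation M := (horizon N).
Local Notation C := (crossing N X).
Local Notation lev := (lev N X).
Hypothesis red : reduced_tiling N X.
Hypothesis f_contact : forall p q j, contact N X p q j -> f p < f q.

(** The quadrant is bounded by the row and the column of [(k, t)]. Unless it starts beyond this row,
    [b] reaches it at a place where it has not yet entered the shape, or turns at a contact joined
    to [(k, t)] by a rectangle of height zero, or crosses the row northwards. *)
Lemma enters_quadrant k t p q b : cell N k t -> ~~ C k t -> lev p t = k ->
    lev q t = k.+1 -> k < n -> lev b t < k ->
  [\/ b < p /\ b < q, f b <= f p |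
    exists d r, [/\ r < t, d + t = k + r, 0 < d, C d r & lev b r.+1 = d]].
Proof.
move=> a c hp hq kn hb.
case: (leqP (k + 0) (lev b 0 + t)) => [past|past]; last first.
  have lp := @lev_lip N X p 0 t isT; have lq := @lev_lip N X q 0 t isT.
  by constructor 1; move: past lp lq => /=; lia.
have [r [rt r1 r2]] := @change_point (fun j => lev b j + t < k + j) 0 t isT
  ltac:(move: past => /=; lia) ltac:(move=> /=; lia).
have [d dE] : exists d, d + t = k + r.
  by exists (k + r - t); have := @lev_gt0 N X b r.+1; lia.
have d0 : 0 < d by have := @lev_gt0 N X b r.+1; lia.
have /and4P[_ o _ _] := a.
have od : ~~ odd (d + r + offset N) by clear -o dE; lia.
have {r1} r1 : d <= lev b r by move: r1; rewrite -leqNgt; clear -dE; lia.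
have {r2} r2 : lev b r.+1 <= d by clear -dE r2; lia.
have [hd|hd] := eqVneq (lev b r) d; last first.
  have [hd1 hd2] : lev b r = d.+1 /\ lev b r.+1 = d.
    by clear -r1 r2 hd; case: (levS N X b r) => -[]; lia.
  constructor 3; exists d, r; split=> //.
  by case: (levS N X b r) => -[]; rewrite hd1 hd2 //; clear; lia.
have nc : ~~ C d r.
  by apply/negP=> cd; have := lev_west hd cd; clear -r2; lia.
have dk : d < k by clear -rt dE; lia.
have [ad|ad] := boolP (cell N d r).
  have [s hs] := @lev_surj N X d.+1 r isT.
  have bs : f b < f s.
    by apply: (f_contact (j := r)); apply: contactE hd hs _ ad nc; clear -dk kn; lia.
  constructor 2; apply: leq_trans (ltnW bs) _; clear r1 r2 hd hb bs.
  apply: (rectangle red f_contact (m := k - d) (k1 := d) (j1 := r) (k2 := k) (j2 := t)) => //;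
    try (clear -dE rt dk kn; lia).
  by move=> k' j' o' h1 h2 h3; apply: (cell_convex ad a) => //; clear -dE rt h1 h2 h3 dk kn; lia.
(* The place [(d, r)] is west of the cell [(k, t)] in its row, so a missing cell there can only mean
   that the diagonal [d] has not started. *)
have rlo : r < lo N d.
  have := @lo_lip N d k; have := @hi_lip N d k; move: a ad; rewrite /cell.
  by clear -dE dk kn od rt; lia.
have bef : forall i, ((lev i r < d) = (i.+1 < d)) * ((lev i r == d) = (i.+1 == d)).
  apply: lev_before; first by clear -d0 dk kn; lia.
  have := @lo_step N d.-1; rewrite prednK // => ls.
  have := @lo_odd N d; have := @lo_odd N d.-1; move=> o1 o2.
  by clear -ls rlo od o1 o2 dk kn d0; lia.
have eb : (b.+1 == d) by rewrite -(bef b) hd.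
constructor 1.
have nb i : d <= lev i r -> i <> b -> b < i.
  move=> h1 h2; have [e1 e2] := bef i; clear -e1 e2 eb h1 h2.
  lia.
have lp := @lev_lip N X p r t ltac:(clear -rt; lia).
have lq := @lev_lip N X q r t ltac:(clear -rt; lia).
split; apply: nb.
- by clear -lp hp dE rt; lia.
- by move=> e; move: hb hp; rewrite e; clear; lia.
- by clear -lq hq dE rt; lia.
- by move=> e; move: hb hq; rewrite e; clear; lia.
Qed.

(** The column of [(k, t)] now replaces the row: [b] ends before crossing it, has a contact in it,
    or crosses it eastwards. *)
Lemma leaves_quadrant k t p q b : cell N k t -> ~~ C k t -> lev p t = k ->
    lev q t = k.+1 -> k < n -> lev b t < k ->
  [\/ lev b M < lev p M /\ lev b M < lev q M, f b <= f p |
    exists g z, [/\ t < z, g + z = k + t, 0 < g, C g z & lev b z = g]].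
Proof.
move=> a c hp hq kn hb.
have /and4P[_ o _ thi] := a.
have tM : t < M := leq_trans thi (hi_horizon (ltnW kn)).
have hp1 : lev p t.+1 = k by apply: lev_west_contact hp c o.
have [fut|fut] := leqP (lev b M + M) (k + t).
  have := @lev_lip N X p t.+1 M tM; have := @lev_lip N X q t M.
  by move=> l1 l2; constructor 1; clear -hp1 hq fut tM l1 l2; lia.
have [z [tz z1 z2]] := @change_point (fun j => k + t < lev b j + j) t M ltac:(lia)
  ltac:(move=> /=; lia) ltac:(move=> /=; lia).
have tz' : t < z.
  have [e|] := eqVneq t z; last by clear -tz; lia.
  rewrite -e in z2; case: (levS N X b t) => -[]; try (by clear -hb z2; lia).
  by move=> /crossing_odd; clear -hb z2 o; lia.
have zkt : z < k + t.
  by have := lev_gt0 N X b z; move: z1; rewrite -leqNgt; clear; lia.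
have [g gE] : exists g, g + z = k + t by exists (k + t - z); clear -zkt; lia.
have g0 : 0 < g by clear -zkt gE; lia.
have gk : g < k by clear -gE tz'; lia.
have og : ~~ odd (g + z + offset N) by clear -o gE; lia.
rewrite -leqNgt in z1.
have {z1} z1 : lev b z <= g by clear -gE z1; lia.
have {z2} z2 : g <= lev b z.+1 by clear -gE z2; lia.
have hg : lev b z = g.
  case: (levS N X b z) => -[]; try (by clear -z1 z2; lia).
  by move=> /crossing_odd; clear -z1 z2 og; lia.
have lpz := @lev_lip N X p t.+1 z tz'.
have lqz := @lev_lip N X q t z (ltnW tz').
have [ag|ag] := boolP (cell N g z); last first.
  have zhi : hi N g <= z.
    have := @lo_lip N g k; have := @hi_lip N g k; move: a ag; rewrite /cell.
    by clear -gE gk kn og tz'; lia.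
  have aft : forall i, ((lev i M < g) = (lev i z < g)) * ((lev i M == g) = (lev i z == g)).
    apply: lev_after; first by clear -g0 gk kn; lia.
    by clear -zhi tz; lia.
  have hbM : lev b M = g by apply/eqP; rewrite (aft b) hg.
  have gM i : g < lev i z -> g < lev i M.
    by have [e1 e2] := aft i; clear -e1 e2; lia.
  constructor 1; rewrite hbM.
  by split; apply: gM; clear -lpz lqz hp1 hq gE tz'; lia.
have [cg|cg] := boolP (C g z).
  by constructor 3; exists g, z; split.
have [s hs] := @lev_surj N X g.+1 z isT.
have bs : f b < f s.
  by apply: (f_contact (j := z)); apply: contactE hg hs _ ag cg; clear -gk kn; lia.
constructor 2; apply: leq_trans (ltnW bs) _; clear z1 z2 hg hb bs lpz lqz.
apply: (rectangle red f_contact (m := k - g) (k1 := g) (j1 := z) (k2 := k) (j2 := t)) => //;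
  try (clear -gE gk kn tz' zkt; lia).
by move=> k' j' o' h1 h2 h3; apply: (cell_convex a ag) => //; clear -gE gk kn tz' zkt h1 h2 h3; lia.
Qed.

(* A pipe passing above a contact meets the northwest quadrant of its cell in a
   path. Unless this path starts or ends inside the quadrant, it contains a
   contact, to which [rectangle] applies. *)
Lemma contact_above k t p q b : cell N k t -> ~~ C k t -> lev p t = k ->
    lev q t = k.+1 -> k < n -> lev b t < k ->
  [\/ b < p /\ b < q, lev b M < lev p M /\ lev b M < lev q M | f b <= f p].
Proof.
move=> a c hp hq kn hb.
case: (enters_quadrant a c hp hq kn hb) => [?|?|[d [r [rt dE d0 cd hd]]]];
  [by constructor 1|by constructor 3|].
case: (leaves_quadrant a c hp hq kn hb) => [?|?|[g [z [tz gE g0 cg hg]]]];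
  [by constructor 2|by constructor 3|].
constructor 3; clear hb.
have /and4P[_ o _ _] := a.
have [ad _ _] := crossing_cell cd; have [ag _ _] := crossing_cell cg.
have od := crossing_odd cd; have og := crossing_odd cg.
(* The parity of level plus time tells vertical edges (even) from horizontal ones (odd). As [b]
   comes in northwards and goes out eastwards, somewhere it enters a cell from the south and leaves
   it to the east: there it is on the SE elbow of a contact. *)
have [y [yr y1 y2]] := @change_point (fun j => ~~ odd (lev b j + j + offset N)) r.+1 z
  ltac:(clear -rt tz; lia) ltac:(cbv beta; rewrite hd; clear -od; lia)
  ltac:(cbv beta; rewrite hg; clear -og; lia).
have [l ly] : exists l, lev b y = l.+1.
  by exists (lev b y).-1; have := lev_gt0 N X b y; clear; lia.
have {y1} ol : ~~ odd (l + y + offset N) by move: y1; rewrite negbK ly; clear; lia.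
have lr := @lev_lip N X b r.+1 y ltac:(clear -yr; lia).
have lz := @lev_lip N X b y z ltac:(clear -yr; lia).
have cy : ~~ C l y.
  by apply/negP=> c'; move: y2; rewrite (lev_south ly c'); clear -ol; lia.
rewrite hd ly in lr; rewrite hg ly in lz.
have [u1 u2] : l + y < k + t /\ t + l < y + k by clear -lr lz yr gE dE o ol; lia.
have u3 : y + g <= z + l by clear -lz og ol yr; lia.
apply: (rectangle red f_contact (m := k - l) (k1 := l) (j1 := y) (k2 := k) (j2 := t)) => //;
  try (clear -u1 u2 dE kn lr rt yr; lia).
move=> k' j' o' h1 h2 h3; apply: (cell_convex ad ag) => //;
  clear -u1 u2 u3 lr dE gE kn h1 h2 h3 o o' ol og od yr g0 rt tz; lia.
Qed.

End Contacts.

(** * Reflection of a network and pipes passing below a contact *)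

Section Flip.

Variables (N : net).
Local Notation n := (width N).

Lemma flip_lo_step k : k < n ->
  lo N (n - k.+1) = (lo N (n - k)).+1 \/ lo N (n - k) = (lo N (n - k.+1)).+1.
Proof.
move=> kn; have := @lo_step N (n - k.+1); rewrite -subSn // subSS; lia.
Qed.

Lemma flip_hi_step k : k < n ->
  hi N (n - k.+1) = (hi N (n - k)).+1 \/ hi N (n - k) = (hi N (n - k.+1)).+1.
Proof.
move=> kn; have := @hi_step N (n - k.+1); rewrite -subSn // subSS; lia.
Qed.

(** The reason for [offset]: replacing [k] by [n - k] changes the parity of cells by that of [n]. *)
Lemma flip_lo_odd k : k <= n -> ~~ odd (k + lo N (n - k) + (offset N + n)).
Proof. by move=> kn; have := @lo_odd N (n - k); lia. Qed.

Lemma flip_hi_odd k : k <= n -> ~~ odd (k + hi N (n - k) + (offset N + n)).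
Proof. by move=> kn; have := @hi_odd N (n - k); lia. Qed.

Lemma flip_lo_hi k : k <= n -> lo N (n - k) <= hi N (n - k).
Proof. by move=> kn; apply: lo_hi; lia. Qed.

Lemma flip_hi_horizon k : k <= n -> hi N (n - k) <= horizon N.
Proof. by move=> kn; apply: hi_horizon; lia. Qed.

(* Reflection along the main diagonal, exchanging west and south. *)
Definition flip : net :=
  Net flip_lo_step flip_hi_step flip_lo_odd flip_hi_odd flip_lo_hi flip_hi_horizon.

Variables (X : nat -> nat -> bool).
Let Y k j := X (n - k) j.

Lemma flip_cell k j : k <= n -> cell flip k j = cell N (n - k) j.
Proof.
move=> kn; rewrite /cell /= kn leq_subr /=; congr (_ && _); lia.
Qed.

Lemma flip_crossing k j : crossing flip Y k j = crossing N X (n - k) j.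
Proof.
rewrite /crossing /Y; case: (leqP k n) => kn.
  rewrite flip_cell //; congr (_ && (_ && _)); rewrite /=; lia.
have ->: n - k = 0 by lia.
by rewrite [0 < 0]/= !andbF /= (ltnNge k) (ltnW kn) !andbF.
Qed.

Lemma flip_lev i j : i < n -> lev flip Y i j = n.+1 - lev N X (n.-1 - i) j.
Proof.
move=> hi; have hi' : n.-1 - i < n by lia.
elim: j => [|j IH]; first by rewrite /=; lia.
have l1 := lev_le_width N X (n.-1 - i) j; have l0 := lev_gt0 N X (n.-1 - i) j.
rewrite /= IH /next_lev. rewrite !flip_crossing.
set d := lev N X _ j in l0 l1 *.
have ->: n - (n.+1 - d) = d.-1 by lia.
have ->: n - (n.+1 - d).-1 = d by lia.
case: ifP => c1; case: ifP => c2 //; try lia.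
by have := crossing_odd c1; have := crossing_odd c2; lia.
Qed.

Lemma flip_reduced : reduced_tiling N X -> reduced_tiling flip Y.
Proof.
move=> red p q j c e.
have [_ _ kn] := crossing_cell c; rewrite /= in kn.
have pn : p < n by rewrite -[n]/(width flip) -(lev_le_width flip Y p j); exact: ltnW.
have qn : q < n by rewrite -[n]/(width flip) -(lev_le_width flip Y q j) e.
rewrite flip_crossing in c; rewrite !flip_lev // in c e kn.
have l1 := lev_le_width N X (n.-1 - p) j; have l0 := lev_gt0 N X (n.-1 - p) j.
have l2 := lev_le_width N X (n.-1 - q) j; have l3 := lev_gt0 N X (n.-1 - q) j.
have := red (n.-1 - q) (n.-1 - p) j.
have ->: lev N X (n.-1 - q) j = n - (n.+1 - lev N X (n.-1 - p) j) by lia.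
by move=> /(_ c); lia.
Qed.

Lemma flip_contact p q j : contact flip Y p q j -> contact N X (n.-1 - q) (n.-1 - p) j.
Proof.
move=> h; have [pn qn] := contact_width h; rewrite /= in pn qn.
case/and4P: h; rewrite /= flip_crossing => h1; rewrite flip_cell ?(ltnW h1) //.
rewrite !flip_lev // in h1 *.
have l1 := lev_le_width N X (n.-1 - p) j; have l0 := lev_gt0 N X (n.-1 - p) j.
have l2 := lev_le_width N X (n.-1 - q) j; have l3 := lev_gt0 N X (n.-1 - q) j.
move=> h2 /eqP h3 h4; rewrite /contact.
have e : lev N X (n.-1 - q) j = n - (n.+1 - lev N X (n.-1 - p) j) by lia.
by rewrite e h2 h4 -e !andbT /=; lia.
Qed.

Variable f : nat -> nat.
Hypothesis red : reduced_tiling N X.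
Hypothesis f_contact : forall p q j, contact N X p q j -> f p < f q.

(** This is [contact_above] in the reflected network; the reflection exchanges the two elbows, so
    both the labels and the values of [f] have to be reversed. *)
Lemma contact_below k t p q b : cell N k t -> ~~ crossing N X k t ->
    lev N X p t = k -> lev N X q t = k.+1 -> k < n -> b < n -> k.+1 < lev N X b t ->
  let fin i := lev N X i (horizon N) in
  [\/ p < b /\ q < b, fin p < fin b /\ fin q < fin b | f q <= f b].
Proof.
move=> a c hp hq kn bn hb fin.
(* Any bound of [f] on the pipes would do: it lets [F - f] reverse the order without truncation. *)
pose F := \sum_(i < n) f i.
have fF i : i < n -> f i <= F.
  by move=> hi; rewrite /F (bigD1 (Ordinal hi)) //= leq_addr.
pose g i := F - f (n.-1 - i).
have g_contact p' q' j : contact flip Y p' q' j -> g p' < g q'.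
  move=> h; have [pn qn] := contact_width h; rewrite /= in pn qn.
  have := f_contact (flip_contact h); rewrite /g.
  have := @fF (n.-1 - p'); have := @fF (n.-1 - q'); lia.
have pn : p < n by rewrite -(lev_le_width N X p t); lia.
have qn : q < n by rewrite -(lev_le_width N X q t); lia.
have k0 : 0 < k by rewrite -hp lev_gt0.
have lb := lev_le_width N X b t.
have fl i : i < n -> forall j, lev flip Y (n.-1 - i) j = n.+1 - lev N X i j.
  move=> hi j; rewrite flip_lev; last lia.
  by have ->: n.-1 - (n.-1 - i) = i by lia.
have := @contact_above flip Y g (flip_reduced red) g_contact (n - k) t
  (n.-1 - q) (n.-1 - p) (n.-1 - b).
rewrite flip_crossing flip_cell ?leq_subr // !fl // subKn ?(ltnW kn) //= => /(_ a c).
have l0 := lev_gt0 N X p (horizon N); have l1 := lev_le_width N X p (horizon N).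
have l2 := lev_gt0 N X q (horizon N); have l3 := lev_le_width N X q (horizon N).
have l4 := lev_gt0 N X b (horizon N); have l5 := lev_le_width N X b (horizon N).
case; try lia.
- by constructor 1; lia.
- by constructor 2; rewrite /fin; lia.
- rewrite /g; have ->: n.-1 - (n.-1 - b) = b by lia.
  have ->: n.-1 - (n.-1 - q) = q by lia.
  by have := fF b bn; have := fF q qn; constructor 3; lia.
Qed.

(* If [u] precedes [b] and [b] precedes [v] in a linear extension, then [u] and
   [v] have no contact. *)
Lemma contact_between u v b t : contact N X u v t -> b < n ->
  let fin i := lev N X i (horizon N) in
  (u < b < v /\ fin v < fin b < fin u) \/ (v < b < u /\ fin u < fin b < fin v) ->
  f b <= f u \/ f v <= f b.
Proof.
move=> h bn fin H; case/and4P: h => h1 h2 /eqP h3 h4.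
have bu : b <> u by lia. 
have bv : b <> v by lia.
have n1 := @lev_neq N X b u t bu; have n2 := @lev_neq N X b v t bv.
(* In either case the alternatives on labels and on exits fail, because [b] lies between [u] and [v]
   for both. *)
case: (ltngtP (lev N X b t) (lev N X u t)) => // hb.
- have := contact_above red f_contact h2 h4 (erefl _) h3 h1 hb.
  by rewrite -/(fin b) -/(fin u) -/(fin v); case; lia.
- have := contact_below h2 h4 (erefl _) h3 h1 bn.
  by rewrite /= -/(fin b) -/(fin u) -/(fin v); case; lia.
Qed.

End Flip.

(** * Exchanging a crossing and a contact *)

Definition swap (a b i : nat) : nat := if i == a then b else if i == b then a else i.

Lemma swapL a b : swap a b a = b.
Proof. by rewrite /swap eqxx. Qed.

Lemma swapR a b : swap a b b = a.
Proof. by rewrite /swap eqxx; case: eqP. Qed.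

Lemma swapD a b i : i <> a -> i <> b -> swap a b i = i.
Proof. by rewrite /swap => /eqP/negbTE-> /eqP/negbTE->. Qed.

Lemma swapK a b : involutive (swap a b).
Proof.
move=> i; case: (eqVneq i a) => [->|/eqP ia]; first by rewrite swapL swapR.
case: (eqVneq i b) => [->|/eqP ib]; first by rewrite swapR swapL.
by rewrite !swapD.
Qed.

Section Local.

Variables (N : net) (X : nat -> nat -> bool).

Lemma next_lev_west k j : cell N k j ->
  next_lev N X j k = if crossing N X k j then k.+1 else k.
Proof.
move=> /and4P[_ o _ _]; rewrite /next_lev; case: ifP => // _.
case: ifP => // h; have := crossing_odd h; have [_ k0 _] := crossing_cell h.
by clear -o k0; lia.
Qed.

Lemma next_lev_south k j : cell N k j ->
  next_lev N X j k.+1 = if crossing N X k j then k else k.+1.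
Proof.
by move=> /and4P[_ o _ _]; rewrite /next_lev /=; case: ifP => // /crossing_odd; clear -o; lia.
Qed.

End Local.

Section Toggle.

Variables (N : net) (X : nat -> nat -> bool).
Local Notation n := (width N).
Local Notation M := (horizon N).
Local Notation C := (crossing N X).
Local Notation lev_in Y := (lev N Y).
Local Notation lev := (lev N X).

Variables (kx jx ky jy a b : nat).
Hypotheses (cx : cell N kx jx) (cy : cell N ky jy) (jxy : jx < jy).
Hypotheses (kx0 : 0 < kx < n) (ky0 : 0 < ky < n).
Let c := C kx jx.
Hypotheses (ax : lev a jx = kx) (bx : lev b jx = kx.+1).
Hypotheses (ay : lev a jy = if c then ky.+1 else ky).
Hypotheses (by_ : lev b jy = if c then ky else ky.+1).

(** Both tiles belong to meetings of [a] and [b]. The Boolean [c] tells whether the earlier one is a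
    crossing, so that delaying a crossing and advancing it are one construction. *)
Definition toggle (k j : nat) : bool :=
  X k j (+) (((k == kx) && (j == jx)) || ((k == ky) && (j == jy))).

Local Notation C' := (crossing N toggle).

Lemma toggle_crossing_x : C' kx jx = ~~ c.
Proof.
rewrite /c /crossing /toggle !eqxx cx kx0 !andbT /=; exact: addbT.
Qed.

Lemma toggle_crossing_y : C' ky jy = ~~ C ky jy.
Proof.
by rewrite /crossing /toggle !eqxx cy ky0 !andbT orbT addbT.
Qed.

Lemma toggle_crossing k j : (k, j) <> (kx, jx) -> (k, j) <> (ky, jy) -> C' k j = C k j.
Proof.
move=> h1 h2; rewrite /crossing /toggle.
have -> : (k == kx) && (j == jx) = false by apply/negP=> /andP[/eqP e /eqP e2]; apply: h1; rewrite e e2.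
have -> : (k == ky) && (j == jy) = false by apply/negP=> /andP[/eqP e /eqP e2]; apply: h2; rewrite e e2.
by rewrite addbF.
Qed.

Lemma toggle_next j d : 0 < d ->
    ~~ ((j == jx) && ((d == kx) || (d == kx.+1))) ->
    ~~ ((j == jy) && ((d == ky) || (d == ky.+1))) ->
  next_lev N toggle j d = next_lev N X j d.
Proof.
move=> d0 h1 h2; rewrite /next_lev !toggle_crossing //; move=> [e1 e2];
  move: h1 h2 kx0 ky0; rewrite ?e1 ?e2 ?eqxx /=; clear -d0 e1; lia.
Qed.

Let window j := jx < j <= jy.

(** The first change interchanges the continuations of [a] and [b], the second one interchanges them
    back; in between the pair occupies the same two levels, so no other pipe notices. *)
Lemma toggle_lev i j :
  lev_in toggle i j = lev (if window j then swap a b i else i) j.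
Proof.
have ab : a <> b by move=> e; move: ax bx; rewrite e; clear; lia.
elim: j i => [|j IH] i; first by [].
rewrite [LHS]/= IH.
have [ejx|njx] := eqVneq j jx.
  have ->: window j = false by rewrite /window; clear -ejx; lia.
  have ->: window j.+1 by rewrite /window; clear -ejx jxy; lia.
  rewrite /swap ejx; case: eqP => [->|na]; last (case: eqP => [->|nb]).
  - by rewrite /= ax bx !(next_lev_west _ cx) !(next_lev_south _ cx) toggle_crossing_x /c; case: (C _ _).
  - by rewrite /= ax bx !(next_lev_west _ cx) !(next_lev_south _ cx) toggle_crossing_x /c; case: (C _ _).
  - have := @lev_neq N X i a jx na; have := @lev_neq N X i b jx nb.
    by rewrite ax bx => h1 h2; apply: toggle_next; first exact: lev_gt0; clear -h1 h2 jxy; lia.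
have [ejy|njy] := eqVneq j jy.
  have ->: window j by rewrite /window; clear -ejy jxy; lia.
  have ->: window j.+1 = false by rewrite /window; clear -ejy; lia.
  rewrite /swap ejy; case: eqP => [->|na]; last (case: eqP => [->|nb]).
  - rewrite /= ay by_; move: c => [];
    by rewrite !(next_lev_west _ cy) !(next_lev_south _ cy) toggle_crossing_y; case: (C _ _).
  - rewrite /= ay by_; move: c => [];
    by rewrite !(next_lev_west _ cy) !(next_lev_south _ cy) toggle_crossing_y; case: (C _ _).
  - have := @lev_neq N X i a jy na; have := @lev_neq N X i b jy nb.
    rewrite ay by_ => h1 h2; apply: toggle_next; first exact: lev_gt0.
      by clear -jxy; lia.
    by move: h1 h2; case: c; clear; lia.
rewrite toggle_next ?lev_gt0 ?(negbTE njx) ?(negbTE njy) //.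
have ->: window j.+1 = window j; last by [].
by rewrite /window; clear -njx njy; lia.
Qed.

Hypothesis red : reduced_tiling N X.
Hypothesis Cy : C ky jy = ~~ c.
Hypothesis ab : a < b.

Lemma window_order j : window j -> if c then lev b j < lev a j else lev a j < lev b j.
Proof.
move=> w; have crx : c -> lev b jx.+1 < lev a jx.+1.
  by move=> h; rewrite (lev_west ax h) (lev_south bx h).
have w1 : jx.+1 <= j by move: w; rewrite /window; clear; lia.
have w2 : j <= jy by move: w; rewrite /window; clear; lia.
move: ay by_ crx; case: c => e1 e2 crx.
  exact: (reduced_crossed red ab w1 (crx isT)).
have := @reduced_crossed N X a b j jy red ab w2; rewrite e1 e2.
have := @lev_neq N X a b j; clear -ab; lia.
Qed.

(** At both ends of the window [a] and [b] have adjacent levels, which leaves no room for [i]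
    between them. *)
Lemma toggle_side i : i <> a -> i <> b ->
  ((lev i jx.+1 < lev a jx.+1) = (lev i jx.+1 < lev b jx.+1)) *
  ((lev i jy < lev a jy) = (lev i jy < lev b jy)).
Proof.
move=> ia ib; have h1 := @lev_neq N X i a jx.+1 ia; have h2 := @lev_neq N X i b jx.+1 ib.
have h3 := @lev_neq N X i a jy ia; have h4 := @lev_neq N X i b jy ib.
split; last by move: h3 h4; rewrite ay by_; case: c; clear; lia.
move: h1 h2; rewrite /= ax bx !(next_lev_west _ cx) !(next_lev_south _ cx).
by case: (C _ _); clear; lia.
Qed.

(** By [toggle_side], changing sides with one of [a], [b] inside the window forces the same change
    with the other. But [a < i < b] allows [i] to cross [a] and [b] in opposite directions only. *)
Lemma no_crossing_between i j : a < i < b -> jx < j < jy ->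
  ~ (C (lev a j) j /\ lev i j = (lev a j).+1) /\ ~ (C (lev i j) j /\ lev b j = (lev i j).+1).
Proof.
move=> aib jj.
have [s1 s2] := @toggle_side i ltac:(clear -aib; lia) ltac:(clear -aib; lia).
have n1 := @lev_neq N X i a jx.+1 ltac:(clear -aib; lia).
have n2 := @lev_neq N X i b jx.+1 ltac:(clear -aib; lia).
have j1 : jx.+1 <= j by clear -jj; lia.
have j2 : j.+1 <= jy by clear -jj; lia.
have j3 : jx.+1 <= jy by clear -jj; lia.
have ai : a < i by clear -aib; lia.
have ib : i < b by clear -aib; lia.
have m1 := @reduced_crossed N X _ _ _ _ red ai j1.
have m2 := @reduced_crossed N X _ _ _ _ red ib j1.
have m3 := @reduced_crossed N X _ _ _ _ red ai j2.
have m4 := @reduced_crossed N X _ _ _ _ red ib j2.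
have m5 := @reduced_crossed N X _ _ _ _ red ai j3.
have m6 := @reduced_crossed N X _ _ _ _ red ib j3.
split=> -[h e]; have [f1 f2] := lev_swapped h e.
- by clear -s1 s2 n1 n2 m1 m3 m6 e f1 f2; lia.
- by clear -s1 s2 n1 n2 m2 m4 m5 e f1 f2; lia.
Qed.

(** Apart from the crossing of the pair itself, interchanging the names [a] and [b] can reverse the
    labels at a crossing only if the third label lies strictly between them, which
    [no_crossing_between] excludes. *)
Lemma toggle_reduced : reduced_tiling N toggle.
Proof.
move=> p q j; rewrite !toggle_lev; case: ifP => w; last first.
  have nejy : j <> jy by move: w; rewrite /window; clear -jxy; lia.
  have [ejx|nejx] := eqVneq j jx.
    rewrite ejx; have [e|ne] := eqVneq (lev p jx) kx.
      by move=> _ e2; rewrite e -bx in e2; rewrite -ax in e; rewrite (lev_inj e) (lev_inj e2).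
    by rewrite toggle_crossing; [exact: red|case=> e; rewrite e eqxx in ne|case=> _; clear -jxy; lia].
  by rewrite toggle_crossing; [exact: red|case=> _ e; rewrite e eqxx in nejx|case].
have wo := window_order w.
have [ejy|nejy] := eqVneq j jy.
  rewrite ejy; have [e|ne] := eqVneq (lev (swap a b p) jy) ky.
    rewrite e toggle_crossing_y Cy negbK => hc e2.
    have e3 : swap a b p = b by apply: (@lev_inj N X _ _ jy); rewrite e by_ hc.
    have e4 : swap a b q = a by apply: (@lev_inj N X _ _ jy); rewrite e2 ay hc.
    by rewrite -[p](swapK a b) e3 -[q](swapK a b) e4 swapR swapL.
  rewrite toggle_crossing; [|by case=> _; clear -jxy; lia|by case=> e; rewrite e eqxx in ne].
  move=> h e2; have pq := red h e2.
  have oy := crossing_odd h.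
  have oky : ~~ odd (ky + jy + offset N) by case/and4P: cy.
  have n1 : swap a b p <> a by move=> e; move: oy ne; rewrite e ay; clear -oky; case: c; lia.
  have n2 : swap a b p <> b by move=> e; move: oy ne; rewrite e by_; clear -oky; case: c; lia.
  have n3 : swap a b q <> a by move=> e; rewrite e ay in e2; move: oy e2 ne; clear -oky; case: c; lia.
  have n4 : swap a b q <> b by move=> e; rewrite e by_ in e2; move: oy e2 ne; clear -oky; case: c; lia.
  by move: pq; rewrite -[p](swapK a b) -[q](swapK a b) !(swapD n1) // !(swapD n3).
have jj : jx < j < jy by move: w; rewrite /window; clear -nejy; lia.
rewrite toggle_crossing; [|by case=> _ ; clear -jj; lia|by case=> _; clear -jj; lia].
move=> h e2; have pq := red h e2.
case: (ltngtP p q) => // hpq; last by move: e2; rewrite hpq; clear; lia.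
exfalso; move: h e2 pq; rewrite /swap.
have nb i := @no_crossing_between i j.
case: (eqVneq p a) => [pa|pa]; first by case: eqP => [qa|qa]; [|case: eqP => [qb|qb]]; move=> h e2 pq;
  clear -pq hpq pa qa ab; lia.
case: (eqVneq p b) => [pb|pb].
  case: (eqVneq q a) => [qa|qa].
    move=> h e2 _.
    case: (boolP c) => hc; rewrite ?hc ?(negbTE hc) in wo; first by clear -wo e2; lia.
    have [f1 f2] := lev_swapped h e2.
    have hj : j.+1 <= jy by clear -jj; lia.
    have := reduced_crossed red ab hj; rewrite f1 f2 => /(_ ltac:(clear; lia)).
    by rewrite ay by_ (negbTE hc); clear; lia.
  case: (eqVneq q b) => [qb|qb]; first by clear -qb pb hpq; lia.
  move=> h e2 pq; have [nb1 _] := nb q ltac:(clear -pq hpq pb; lia) jj.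
  by apply: nb1.
case: (eqVneq q a) => [qa|qa].
  move=> h e2 pq; have [_ nb1] := nb p ltac:(clear -pq hpq qa; lia) jj.
  by apply: nb1.
case: (eqVneq q b) => [qb|qb]; move=> h e2 pq; clear -pq hpq qb ab; lia.
Qed.

(** The side conditions of the last alternative say that the contact is not at a toggled cell; they
    discard the contact that has been turned into a crossing. *)
Lemma toggle_contact u v j : contact N toggle u v j ->
  [\/ [/\ j = jx, u = a & v = b] /\ c,
      [/\ j = jy, u = b & v = a] /\ ~~ c |
      contact N X (if window j then swap a b u else u) (if window j then swap a b v else v) j /\
      (j = jx -> u <> a) /\ (j = jy -> swap a b u <> if c then b else a)].
Proof.
rewrite /contact !toggle_lev.
set u' := if _ then _ else u; set v' := if _ then _ else v.
case/and4P=> h1 h2 h3 h4.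
have [e1|ne1] := eqVneq j jx.
  have w : window j = false by rewrite /window e1; clear; lia.
  rewrite /u' /v' w e1 in h1 h2 h3 h4 *.
  have [e|ne] := eqVneq (lev u jx) kx.
    constructor 1; rewrite e toggle_crossing_x negbK in h4; split=> //; split=> //.
      by apply: (@lev_inj N X _ _ jx); rewrite e.
    by apply: (@lev_inj N X _ _ jx); rewrite (eqP h3) e.
  rewrite toggle_crossing in h4; [|by case=> e; rewrite e eqxx in ne|by case=> _; clear -jxy; lia].
  constructor 3; split; first by rewrite h1 h2 h3.
  by split=> [_ e|]; [rewrite e ax eqxx in ne|clear -jxy; lia].
have [e1'|ne1'] := eqVneq j jy.
  have w : window j by rewrite /window e1'; clear -jxy; lia.
  rewrite /u' /v' w e1' in h1 h2 h3 h4 *.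
  have [e|ne] := eqVneq (lev (swap a b u) jy) ky.
    rewrite e toggle_crossing_y Cy negbK in h4.
    have e2 := eqP h3; rewrite e in e2.
    case: (boolP c) h4 => // hc _.
    constructor 2; split=> //.
    have e3 : swap a b u = a by apply: (@lev_inj N X _ _ jy); rewrite e ay (negbTE hc).
    have e4 : swap a b v = b by apply: (@lev_inj N X _ _ jy); rewrite e2 by_ (negbTE hc).
    by rewrite -[u](swapK a b) e3 -[v](swapK a b) e4 swapR swapL.
  rewrite toggle_crossing in h4; [|by case=> _; clear -jxy; lia|by case=> e; rewrite e eqxx in ne].
  constructor 3; split; first by rewrite h1 h2 h3.
  split=> [|_]; first by clear -jxy; lia.
  by move=> e; rewrite e in ne; move: ne ay by_; case: c => h5 h6 h7; rewrite ?h6 ?h7 eqxx in h5.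
rewrite toggle_crossing in h4;
  [|by case=> _ e; rewrite e eqxx in ne1|by case=> _ e; rewrite e eqxx in ne1'].
constructor 3; split; first by rewrite h1 h2 h3.
by split=> e; rewrite e eqxx in ne1 ne1'.
Qed.

Lemma toggle_horizon i : lev_in toggle i M = lev i M.
Proof.
have jM : jy < M by case/and4P: cy => h _ _ h2; apply: leq_trans h2 (hi_horizon h).
by rewrite toggle_lev; have -> : window M = false by rewrite /window; clear -jM; lia.
Qed.

End Toggle.

(** * Pipe dreams compatible with a given order of the pipes *)

Section Tilings.

Variable N : net.
Local Notation n := (width N).
Local Notation M := (horizon N).

Definition compatible (X : nat -> nat -> bool) (f : nat -> nat) : Prop :=
  forall p q j, contact N X p q j -> f p < f q.

Definition same_crossings (X Y : nat -> nat -> bool) : Prop :=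
  forall k j, crossing N X k j = crossing N Y k j.

Lemma same_lev X Y : same_crossings X Y -> forall i j, lev N X i j = lev N Y i j.
Proof.
move=> h i; elim=> // j IH; by rewrite /= IH /next_lev !h.
Qed.

Lemma same_contact X Y : same_crossings X Y ->
  forall p q j, contact N X p q j = contact N Y p q j.
Proof. by move=> h p q j; rewrite /contact !(same_lev h) h. Qed.

Section CrossingPair.

Variables (X : nat -> nat -> bool) (a b : nat).
Local Notation C := (crossing N X).
Local Notation lev := (lev N X).
Hypotheses (red : reduced_tiling N X) (ab : a < b).

Definition crosses j := C (lev a j) j && (lev b j == (lev a j).+1).

Lemma crosses_lt j j' : crosses j -> j < j' -> lev b j' < lev a j'.
Proof.
case/andP=> h /eqP e jj; have [f1 f2] := lev_swapped h e.
by apply: (reduced_crossed red ab jj); rewrite f1 f2.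
Qed.

Lemma crosses_gt j j' : crosses j -> j' <= j -> lev a j' < lev b j'.
Proof.
case/andP=> h /eqP e jj; have := reduced_crossed red ab jj; rewrite e.
by have := @lev_neq N X a b j'; clear -ab; lia.
Qed.

Lemma crosses_uniq j j' : crosses j -> crosses j' -> j = j'.
Proof.
move=> h h'; have := @crosses_lt j j' h; have := @crosses_lt j' j h'.
have := @crosses_gt j j h (leqnn _); have := @crosses_gt j' j' h' (leqnn _).
clear; lia.
Qed.

(** At such a contact the pair is already inverted, whereas the pipes start in increasing order. *)
Lemma crosses_before j : contact N X b a j -> exists2 i, i < j & crosses i.
Proof.
case/and4P=> _ _ /eqP e _.
have [//|||i [ij h e2]] := @lev_crossing N X a b 0 j; first by [].
  by rewrite e.
by exists i; rewrite /crosses ?h ?e2 ?eqxx.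
Qed.

Lemma contact_cell p q j : contact N X p q j ->
  [/\ cell N (lev p j) j, 0 < lev p j < n, ~~ C (lev p j) j & lev q j = (lev p j).+1].
Proof. by case/and4P=> h1 h2 /eqP h3 h4; rewrite lev_gt0. Qed.

Lemma contact_lt_horizon p q j : contact N X p q j -> j < M.
Proof.
by case/and4P=> h /and4P[h1 _ _ h2] _ _; apply: leq_trans h2 (hi_horizon h1).
Qed.

Lemma crosses_cell j : crosses j ->
  [/\ cell N (lev a j) j, 0 < lev a j < n, C (lev a j) j & lev b j = (lev a j).+1].
Proof. by case/andP=> h /eqP e; case/crossing_cell: (h) => h1 h2 h3; rewrite h2 h3. Qed.

End CrossingPair.

Section Uncross.

Variables (X : nat -> nat -> bool) (a b jx jy : nat).
Hypotheses (red : reduced_tiling N X) (ab : a < b).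
Hypotheses (cr : crosses X a b jx) (ct : contact N X b a jy) (jxy : jx < jy).

Definition uncross := toggle X (lev N X a jx) jx (lev N X b jy) jy.

Let c : crossing N X (lev N X a jx) jx.
Proof. by case/andP: cr. Qed.

Lemma uncross_lev i j :
  lev N uncross i j = lev N X (if jx < j <= jy then swap a b i else i) j.
Proof.
have [h1 h2 h3 h4] := crosses_cell cr; have [g1 g2 g3 g4] := contact_cell ct.
by apply: toggle_lev; rewrite ?c.
Qed.

Lemma uncross_reduced : reduced_tiling N uncross.
Proof.
have [h1 h2 h3 h4] := crosses_cell cr; have [g1 g2 g3 g4] := contact_cell ct.
by apply: (@toggle_reduced N X _ _ _ _ a b); rewrite ?c ?(negbTE g3).
Qed.

Lemma uncross_horizon i : lev N uncross i M = lev N X i M.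
Proof.
have [h1 h2 h3 h4] := crosses_cell cr; have [g1 g2 g3 g4] := contact_cell ct.
by apply: (@toggle_horizon N X _ _ _ _ a b); rewrite ?c.
Qed.

Lemma uncross_contact u v j : contact N uncross u v j ->
  [/\ j = jx, u = a & v = b] \/
  contact N X (if jx < j <= jy then swap a b u else u)
              (if jx < j <= jy then swap a b v else v) j.
Proof.
have [h1 h2 h3 h4] := crosses_cell cr; have [g1 g2 g3 g4] := contact_cell ct.
case/(@toggle_contact N X _ _ _ _ a b); rewrite ?c ?(negbTE g3) //; try by case.
- by case=> h _; left.
- by case=> h _; right.
Qed.

Lemma uncross_crossing k j : crossing N X k j =
  crossing N uncross k j (+) (((k == lev N X a jx) && (j == jx)) || ((k == lev N X b jy) && (j == jy))).
Proof.
have [h1 h2 h3 h4] := crosses_cell cr; have [g1 g2 g3 g4] := contact_cell ct.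
have [/andP[/eqP-> /eqP->]|nx] := boolP ((k == _) && (j == jx)).
  by rewrite toggle_crossing_x // addbT negbK.
have [/andP[/eqP-> /eqP->]|ny] := boolP ((k == _) && (j == jy)).
  by rewrite toggle_crossing_y // addbT negbK.
rewrite addbF toggle_crossing //.
  by case=> e1 e2; rewrite e1 e2 !eqxx in nx.
by case=> e1 e2; rewrite e1 e2 !eqxx in ny.
Qed.

End Uncross.

(* Uncrossing delays a crossing, so it terminates on a pipe dream in which every
   pair crosses at its last meeting. *)
Definition weight X := \sum_(p : 'I_n.+1 * 'I_M) crossing N X p.1 p.2 * p.2.

Lemma weight_uncross X a b jx jy : crosses X a b jx -> contact N X b a jy -> jx < jy ->
  weight X < weight (uncross X a b jx jy).
Proof.
move=> cr ct jxy.
have [h1 h2 h3 h4] := crosses_cell cr; have [g1 g2 g3 g4] := contact_cell ct.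
have jyM := contact_lt_horizon ct; have jxM := ltn_trans jxy jyM.
have kxn : lev N X a jx < n.+1 by clear -h2; lia.
have kyn : lev N X b jy < n.+1 by clear -g2; lia.
pose px := (Ordinal kxn, Ordinal jxM); pose py := (Ordinal kyn, Ordinal jyM).
have pxy : py != px by apply/eqP=> -[_ e]; move: jxy; rewrite e ltnn.
rewrite /weight (bigD1 px) //= [in X in _ < X](bigD1 px) //=.
rewrite (bigD1 py) //= [in X in _ < _ + X](bigD1 py) //=.
have E := uncross_crossing cr ct.
have Ex := E (lev N X a jx) jx; rewrite h3 !eqxx /= addbT in Ex.
have Ey := E (lev N X b jy) jy; rewrite (negbTE g3) !eqxx orbT /= addbT in Ey.
have {}Ex : crossing N (uncross X a b jx jy) (lev N X a jx) jx = false by apply/negbTE.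
have {}Ey : crossing N (uncross X a b jx jy) (lev N X b jy) jy.
  by apply: negbFE; rewrite -Ey.
rewrite h3 (negbTE g3) Ex Ey !mul1n !mul0n !add0n.
under eq_bigr => p /andP[/eqP ne1 /eqP ne2].
  rewrite E; have -> : (val p.1 == lev N X a jx) && (val p.2 == jx) = false.
    by apply/negP=> /andP[/eqP e1 /eqP e2]; apply: ne1; case: p e1 e2 {ne2} => p1 p2 /= e1 e2;
      congr pair; apply: val_inj.
  have -> : (val p.1 == lev N X b jy) && (val p.2 == jy) = false.
    by apply/negP=> /andP[/eqP e1 /eqP e2]; apply: ne2; case: p e1 e2 {ne1} => p1 p2 /= e1 e2;
      congr pair; apply: val_inj.
  rewrite addbF; over.
by rewrite ltn_add2r.
Qed.

Lemma weight_bound X : weight X <= \sum_(p : 'I_n.+1 * 'I_M) p.2.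
Proof. by apply: leq_sum => p _; case: (crossing _ _ _ _); rewrite ?mul1n ?mul0n. Qed.

Variable fin : nat -> nat.

Definition realizes (X : nat -> nat -> bool) : Prop :=
  reduced_tiling N X /\ forall i, i < n -> lev N X i M = fin i.

Lemma uncross_realizes X a b jx jy : a < b -> realizes X ->
    crosses X a b jx -> contact N X b a jy -> jx < jy ->
  realizes (uncross X a b jx jy).
Proof.
move=> ab [red h] cr ct jxy; split; first exact: uncross_reduced.
by move=> i /h <-; apply: uncross_horizon.
Qed.

(** A violation is a contact with the larger label on the NW elbow; it follows the crossing of its
    two pipes, which [uncross] delays. The bounded weight ends the process. *)
Lemma exists_compatible_id X : realizes X -> exists Y, realizes Y /\ compatible Y id.
Proof.
move: {2}(_ - _) (leqnn (\sum_(p : 'I_n.+1 * 'I_M) p.2 - weight X)) => m.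
elim: m X => [|m IH] X hm rX; have [red _] := rX.
  exists X; split=> // p q j h; case: (ltngtP p q) => // pq; last first.
    by move: h; rewrite /contact pq; clear; lia.
  have [i ij cr] := crosses_before pq h.
  have := weight_uncross cr h ij; have := weight_bound (uncross X q p i j).
  by move: hm; clear; lia.
case: (classic (compatible X id)) => [|nc]; first by exists X.
have [b [a [j [h ab]]]] : exists b a j, contact N X b a j /\ a < b.
  apply: NNPP => nex; apply: nc => p q j h; case: (ltngtP p q) => // pq.
    by case: nex; exists p, q, j.
  by move: h; rewrite /contact pq; clear; lia.
have [i ij cr] := crosses_before ab h.
apply: (IH (uncross X a b i j)); last exact: uncross_realizes.
have := weight_uncross cr h ij; have := weight_bound (uncross X a b i j).
by move: hm; clear; lia.
Qed.

Lemma crossing_horizon X k j : M <= j -> crossing N X k j = false.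
Proof.
by move=> h; apply/negP=> /crossing_bound[_ _]; rewrite ltnNge h.
Qed.

Lemma lev_horizon_width X i : n <= i -> forall j, lev N X i j = i.+1.
Proof.
move=> ni; elim=> // j IH; case: (levS N X i j) => -[]; rewrite IH //; clear -ni; lia.
Qed.

(** Going back from the common exits, the pipes that leave a cell determine its tile: where one
    tiling has a crossing, a contact in the other would put the larger label on the NW elbow. *)
Lemma unique_compatible_id X Y : realizes X -> realizes Y ->
  compatible X id -> compatible Y id -> same_crossings X Y.
Proof.
move=> rX rY cX cY.
suff H m : (forall i, lev N X i (M - m) = lev N Y i (M - m)) /\
           forall k j, M - m <= j -> crossing N X k j = crossing N Y k j.
  by have [_ h] := H M; move=> k j; apply: h; rewrite subnn.
have mono X' Y' j : realizes X' -> compatible Y' id ->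
    (forall i, lev N X' i j.+1 = lev N Y' i j.+1) ->
    forall k, crossing N X' k j -> crossing N Y' k j.
  move=> [red _] cY' h k c; apply/negPn/negP=> nc.
  have [a k0 kn] := crossing_cell c; have o := crossing_odd c.
  have [p hp] := @lev_surj N X' k j k0; have [q hq] := @lev_surj N X' k.+1 j isT.
  have pq : p < q by apply: (red p q j); rewrite hp.
  have [_ hp'] := @lev_contact_prev N Y' k j p nc o.
  have [hq' _] := @lev_contact_prev N Y' k j q nc o.
  have := cY' q p j; apply/implyP; rewrite negb_imply.
  rewrite (@contactE N Y' q p j k) //.
  - by clear -pq; lia.
  - by apply: hq'; rewrite -h (lev_south hq).
  - by apply: hp'; rewrite -h (lev_west hp).
elim: m => [|m [IH1 IH2]].
  rewrite subn0; split=> [i|k j h]; last by rewrite !crossing_horizon.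
  have [ni|ni] := leqP n i; first by rewrite !lev_horizon_width.
  by case: rX rY => _ hX [_ hY]; rewrite hX ?hY.
have [Mm|mM] := leqP M m; first by have -> : M - m.+1 = M - m by lia.
have e : M - m = (M - m.+1).+1 by lia.
have E k : crossing N X k (M - m.+1) = crossing N Y k (M - m.+1).
  rewrite e in IH1; apply/idP/idP; first exact: mono IH1 _.
  by apply: mono => // i; rewrite IH1.
split=> [i|k j h]; last first.
  by have [->//|ne] := eqVneq j (M - m.+1); apply: IH2; lia.
apply: (@next_lev_inj N X (M - m.+1)); rewrite ?lev_gt0 //.
have := IH1 i; rewrite e /= => ->.
by rewrite /next_lev !E.
Qed.

Section Step.

Variables (f : nat -> nat) (a b : nat).
Hypotheses (ab : a < b) (bn : b < n) (fin_ba : fin b < fin a).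
Local Notation g := (fun i => f (swap a b i)).

(* [a] and [b] have consecutive images under [f], in this order. *)
Hypothesis f_swap : forall u v, f u < f v -> (u, v) <> (a, b) -> g u < g v.
Hypothesis f_ab : f a < f b.

Lemma g_swap u v : g u < g v -> (u, v) <> (b, a) -> f u < f v.
Proof.
move=> h ne; rewrite -[u](swapK a b) -[v](swapK a b); apply: f_swap => // -[e1 e2].
by apply: ne; rewrite -[u](swapK a b) -[v](swapK a b) e1 e2 swapL swapR.
Qed.

(** What a move preserves: up to contacts of the pair itself, nothing appears that was not present
    before or after renaming. *)
Definition swapped_contacts X Y := forall u v j, contact N Y u v j ->
  [\/ (u = a /\ v = b) \/ (u = b /\ v = a), contact N X u v j |
    contact N X (swap a b u) (swap a b v) j].

(** The last contact of [b] with [a] is exchanged with their crossing. The final clause undoes the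
    move from [Y] alone, through the first contact and the only crossing of the pair; uniqueness
    rests on it. *)
Lemma step_down X : realizes X -> compatible X g ->
  exists Y, [/\ realizes Y, compatible Y f, swapped_contacts X Y &
    same_crossings X Y /\ (forall j, ~~ contact N Y a b j) \/
    exists jx jy, [/\ contact N Y a b jx, forall j, contact N Y a b j -> jx <= j,
      crosses Y a b jy & forall k j, crossing N X k j =
      crossing N Y k j (+) (((k == lev N Y a jx) && (j == jx)) ||
                            ((k == lev N Y a jy) && (j == jy)))]].
Proof.
move=> rX cX; have [red hX] := rX.
case: (classic (exists j, contact N X b a j)) => [exc|nc]; last first.
  have nab j : ~~ contact N X a b j.
    by apply/negP=> /cX; rewrite swapL swapR => h; move: f_ab h; clear; lia.
  exists X; split=> //.
  - move=> u v j h; apply: (g_swap (cX _ _ _ h)) => -[e1 e2].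
    by apply: nc; exists j; rewrite -e1 -e2.
  - by move=> u v j h; constructor 2.
  - by left.
pose jy := ex_maxn exc (fun j h => ltnW (contact_lt_horizon h)).
have [ct ctmax] : contact N X b a jy /\ forall j, contact N X b a j -> j <= jy.
  by rewrite /jy; case: ex_maxnP.
have [jx jxy cr] := crosses_before ab ct.
have [h1 h2 h3 h4] := crosses_cell cr; have [g1 g2 g3 g4] := contact_cell ct.
have UL := uncross_lev cr ct jxy; have UC := uncross_crossing cr ct.
have wx : (jx < jx <= jy) = false by rewrite ltnn.
have wy : jx < jy <= jy by rewrite jxy leqnn.
exists (uncross X a b jx jy); split.
- exact: uncross_realizes.
- move=> u v j /(uncross_contact cr ct jxy)[[_ -> ->]//|].
  case: ifP => w h; first by have := cX _ _ _ h; rewrite !swapK.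
  (* A remaining contact of [b] with [a] would occur no later than [jx], by the choice of [jy]; but
     there the pair is not inverted yet. *)
  apply: (g_swap (cX _ _ _ h)) => -[e1 e2]; rewrite e1 e2 in h.
  have j1 := ctmax _ h; have [_ _ _ l] := contact_cell h.
  have := @crosses_gt X a b red ab jx j cr; rewrite l; move: w j1; clear; lia.
- move=> u v j /(uncross_contact cr ct jxy)[[_ -> ->]|]; first by constructor 1; left.
  by case: ifP => _ h; [constructor 3|constructor 2].
- right; exists jx, jy; split.
  + apply: (contactE (k := lev N X a jx)); rewrite ?UL ?wx //.
      by clear -h2; lia.
    by have := UC (lev N X a jx) jx; rewrite h3 !eqxx addbT => <-.
  + move=> j /(uncross_contact cr ct jxy)[[->]//|].
    case: ifP => w h; first by move: w; clear; lia.
    by have := cX _ _ _ h; rewrite swapL swapR; move: f_ab; clear; lia.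
  + rewrite /crosses !UL wy swapL swapR g4 eqxx andbT.
    by have := UC (lev N X b jy) jy; rewrite (negbTE g3) !eqxx orbT addbT => /esym/negbFE.
  + by move=> k j; rewrite UC !UL wx wy swapL.
Qed.

(** Here the first contact is exchanged with the crossing that must follow it, since the exits are
    inverted. No contact of [a] with [b] comes earlier by minimality, nor after the crossing, where
    [b] has the lower level. *)
Lemma step_up X : realizes X -> compatible X f ->
  exists Y, [/\ realizes Y, compatible Y g & swapped_contacts X Y].
Proof.
move=> rX cX; have [red hX] := rX.
case: (classic (exists j, contact N X a b j)) => [exc|nc]; last first.
  exists X; split=> //.
  - move=> u v j h; apply: (f_swap (cX _ _ _ h)) => -[e1 e2].
    by apply: nc; exists j; rewrite -e1 -e2.
  - by move=> u v j h; constructor 2.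
pose jx := ex_minn exc.
have [ct ctmin] : contact N X a b jx /\ forall j, contact N X a b j -> jx <= j.
  by rewrite /jx; case: ex_minnP.
have [g1 g2 g3 g4] := contact_cell ct.
have jxM := contact_lt_horizon ct.
have [||jy [jxy h3 h4]] := @lev_crossing N X a b jx M (ltnW jxM).
- by rewrite g4.
- by rewrite !hX ?(ltn_trans ab).
have cr : crosses X a b jy by rewrite /crosses h3 h4 eqxx.
have {}jxy : jx < jy.
  have [e|] := eqVneq jx jy; first by rewrite -e (negbTE g3) in h3.
  by move: jxy; clear; lia.
have [h1 h2 _ _] := crosses_cell cr.
have nc : crossing N X (lev N X a jx) jx = false by apply/negbTE.
pose Y := toggle X (lev N X a jx) jx (lev N X a jy) jy.
exists Y; split.
- split; first by apply: (@toggle_reduced N X _ _ _ _ a b); rewrite ?nc.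
  move=> i /hX <-.
  by apply: (@toggle_horizon N X _ _ _ _ a b); rewrite ?nc.
- move=> u v j /(@toggle_contact N X _ _ _ _ a b); rewrite ?nc.
  case=> //; first by case.
    by move=> [[_ -> ->] _]; rewrite swapL swapR.
  case: ifP => w [h [k1 k2]]; first exact: cX h.
  apply: (f_swap (cX _ _ _ h)) => -[e1 e2]; rewrite e1 e2 in h.
  have j1 := ctmin _ h; have [_ _ _ l] := contact_cell h.
  have := @crosses_lt X a b red ab jy j cr; rewrite l.
  have [e|] := eqVneq j jx; first by case: (k1 e).
  by move: w j1; clear; lia.
- move=> u v j /(@toggle_contact N X _ _ _ _ a b); rewrite ?nc.
  case=> //; first by case.
    by move=> [[_ -> ->] _]; constructor 1; right.
  by case: ifP => w [h _]; [constructor 3|constructor 2].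
Qed.

(** Both tilings are recovered in the same way from the tiling compatible with [f], which is
    unique. *)
Lemma unique_up :
  (forall X Y, realizes X -> realizes Y -> compatible X f -> compatible Y f -> same_crossings X Y) ->
  forall X Y, realizes X -> realizes Y -> compatible X g -> compatible Y g -> same_crossings X Y.
Proof.
move=> uf X Y rX rY cX cY.
have [X' [rX' cX' _ HX]] := step_down rX cX.
have [Y' [rY' cY' _ HY]] := step_down rY cY.
have S := uf _ _ rX' rY' cX' cY'.
case: HX => [[SX nX]|[jx [jy [x1 x2 x3 x4]]]]; case: HY => [[SY nY]|[jx' [jy' [y1 y2 y3 y4]]]].
- by move=> k j; rewrite SX S -SY.
- by have := nX jx'; rewrite (same_contact S) y1.
- by have := nY jx; rewrite -(same_contact S) x1.
- have ex : jx = jx'.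
    by apply/eqP; rewrite eqn_leq x2 ?y2 // ?(same_contact S) // -(same_contact S).
  have ey : jy = jy'.
    case: rX' => red _; apply: (crosses_uniq red ab x3).
    by rewrite /crosses !(same_lev S) S.
  by move=> k j; rewrite x4 y4 S !(same_lev S) ex ey.
Qed.

End Step.

End Tilings.

(** * Local criterion for congruences *)

Section JoinCongruence.

Variables (T : Type) (D : pred T) (le : rel T) (step E : T -> T -> Prop).
Variables (rk : T -> nat) (dist : T -> T -> nat) (bot : T).

Definition contracted (x y : T) : Prop := [/\ x \in D, y \in D, step x y & E x y].
Local Notation chain := (clos_refl_trans_1n T contracted).

Hypothesis le_refl : reflexive le.
Hypothesis le_trans : transitive le.
Hypothesis le_anti : antisymmetric le.
Hypothesis E_equiv : equivalence_on D E.
Hypothesis bot_D : bot \in D.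
Hypothesis bot_le : forall x, x \in D -> le bot x.
Hypothesis step_exists : forall x y, x \in D -> y \in D -> le x y -> x <> y ->
  exists t, [/\ t \in D, step x t & le t y].
Hypothesis step_le : forall x y, step x y -> le x y.
Hypothesis step_rk : forall x y, step x y -> rk y < rk x.
(** The polygon condition: a contracted edge at the bottom of a polygon contracts the opposite
    side. *)
Hypothesis step_join : forall x y z, x \in D -> y \in D -> z \in D ->
  step x y -> step x z -> y <> z ->
  exists m, is_join D le y z m /\ (E x y -> chain z m).
Hypothesis E_step : forall x y, x \in D -> y \in D -> E x y -> x <> y ->
  exists t, [/\ t \in D, E x t, step x t \/ step t x & dist t y < dist x y].

Lemma chain_le x y : chain x y -> le x y.
Proof.
by elim=> [//|a b c [_ _ h _] _ h2]; apply: le_trans h2; apply: step_le.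
Qed.

Lemma chain_D x y : chain x y -> x \in D -> y \in D.
Proof. by elim=> // a b c [_ h _ _] _ h2 _; apply: h2. Qed.

Lemma chain_trans x y z : chain x y -> chain y z -> chain x z.
Proof. by elim=> // a b c h _ h2 /h2; apply: rt1n_trans. Qed.

Lemma chain_E x y : chain x y -> x \in D -> E x y.
Proof.
case: E_equiv => r s t; elim=> [a /r //|a b c [ha hb _ hE] hc h _].
by apply: (t a b c) => //; [exact: chain_D hc hb | exact: h].
Qed.

(** The argument of Björner, Edelman and Ziegler, by induction on the corank of a common lower bound
    [b]. Let [u] and [v] be steps from [b] towards [x] and [y], with join [m]: joining [x] with [m]
    above [u], and the result with [y] above [v], gives the join. *)
Lemma join_exists x y : x \in D -> y \in D -> exists m, is_join D le x y m.
Proof.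
move=> xD yD.
suff H k b : rk b < k -> b \in D -> forall x y, x \in D -> y \in D -> le b x -> le b y ->
    exists m, is_join D le x y m.
  exact: (H (rk bot).+1 bot (ltnSn _) bot_D _ _ xD yD (bot_le xD) (bot_le yD)).
elim: k b {x y xD yD} => // k IH b bk bD x y xD yD bx by_.
case: (classic (b = x)) => [<-|nx].
  by exists y; split=> // z zD _ h.
case: (classic (b = y)) => [<-|ny].
  by exists x; split=> // z zD h _.
have [u [uD su ux]] := step_exists bD xD bx nx.
have [v [vD sv vy]] := step_exists bD yD by_ ny.
have ku : rk u < k := leq_trans (step_rk su) bk.
have kv : rk v < k := leq_trans (step_rk sv) bk.
case: (classic (u = v)) => [e|ne]; first by apply: (IH u) => //; rewrite e.
have [m [[mD um vm hm] _]] := step_join bD uD vD su sv ne.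
have [p [pD xp mp hp]] := IH u ku uD x m xD mD ux um.
have [q [qD pq yq hq]] := IH v kv vD p y pD yD (le_trans vm mp) vy.
exists q; split=> //; first exact: le_trans xp pq.
move=> z zD xz yz; apply: hq => //; apply: hp => //; apply: hm => //.
  exact: le_trans ux xz.
exact: le_trans vy yz.
Qed.

(** Contraction is pushed from [x] up to [z]: a step from [x] to [t] below [z] spans a polygon with
    the first link of the chain, and its opposite side is a contracted chain starting at [t], which
    is closer to the top. *)
Lemma chain_join k x y : rk x < k -> x \in D -> chain x y ->
  forall z m, z \in D -> le x z -> is_join D le z y m -> chain z m.
Proof.
elim: k x y => // k IH x y xk xD hc.
case: hc xk xD => [|x1 y' [_ x1D s1 e1] hc] xk xD z m zD xz [mD zm ym hm].
  have -> : m = z by apply: le_anti; rewrite zm hm.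
  exact: rt1n_refl.
have k1 : rk x1 < k := leq_trans (step_rk s1) xk.
have [m1 [m1D zm1 x1m1 hm1]] := join_exists zD x1D.
(* It suffices to treat the first link: the rest of the chain starts at [x1], and induction applies
   to it and [m1]. *)
have c1 : chain z m1; last first.
  apply: chain_trans c1 _; apply: (IH x1 y' k1 x1D hc) => //.
  split=> // [|t tD h1 h2].
    by apply: hm1 => //; apply: le_trans ym; apply: chain_le.
  by apply: hm => //; apply: le_trans h1.
case: (classic (x = z)) => [e|nz].
  have -> : m1 = x1 by apply: le_anti; rewrite x1m1 hm1 // -e; apply: step_le.
  by rewrite -e; apply: rt1n_trans (rt1n_refl _ _ _); split.
have [x1z|nx1z] := boolP (le x1 z).
  have -> : m1 = z by apply: le_anti; rewrite zm1 hm1.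
  exact: rt1n_refl.
have [t [tD st tz]] := step_exists xD zD xz nz.
have ne : x1 <> t by move=> e; rewrite e tz in nx1z.
have [m' [[m'D x1m' tm' hm'] /(_ e1) c]] := step_join xD x1D tD s1 st ne.
have kt : rk t < k := leq_trans (step_rk st) xk.
apply: (IH t m' kt tD c) => //.
split=> // [|u uD zu m'u].
  by apply: hm' => //; apply: le_trans zm1.
by apply: hm1 => //; apply: le_trans m'u.
Qed.

Lemma contracted_join x x' y m m' : y \in D -> contracted x x' ->
  is_join D le x y m -> is_join D le x' y m' -> E m m'.
Proof.
move=> yD [xD x'D s e] [mD xm ym hm] [m'D x'm' ym' hm'].
apply: (chain_E _ mD).
apply: (@chain_join (rk x).+1 x x' (ltnSn _) xD) => //.
  by apply: rt1n_trans (rt1n_refl _ _ _); split.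
split=> // [|z zD mz x'z]; last by apply: hm' => //; apply: le_trans mz.
by apply: hm => //; apply: le_trans x'm'; apply: step_le.
Qed.

(** Classes are connected by steps between their elements, so a contracted step up or down is
    treated at a time. *)
Lemma join_left x x' y m m' : x \in D -> x' \in D -> y \in D -> E x x' ->
  is_join D le x y m -> is_join D le x' y m' -> E m m'.
Proof.
case: (E_equiv) => r s t xD x'D yD.
have [k hk] : exists k, dist x x' < k by exists (dist x x').+1.
elim: k x xD m hk => // k IH x xD m hk e hm hm'.
have [mD xm ym hm1] := hm; have [m'D x'm' ym' hm1'] := hm'.
case: (classic (x = x')) => [ex|ne].
  have -> : m' = m by apply: le_anti; rewrite hm1 ?hm1' // ?ex // -ex.
  exact: r.
have [u [uD xu su du]] := E_step xD x'D e ne.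
have ku : dist u x' < k := leq_trans du hk.
have [p hp] := join_exists uD yD; have [pD _ _ _] := hp.
apply: (@t m p m') => //.
  case: su => su; first by apply: (contracted_join yD _ hm hp); split.
  apply: (s) => //; apply: (contracted_join yD _ hp hm); split=> //.
  exact: s.
apply: (IH u) => //.
by apply: (t u x x') => //; apply: s.
Qed.

Lemma join_compatible : compatible_on D (is_join D le) E.
Proof.
move=> x x' y y' m m' xD x'D yD y'D ex ey hm hm'.
have [p hp] := join_exists x'D yD.
have C a b c : is_join D le a b c -> is_join D le b a c.
  by case=> h1 h2 h3 h4; split=> // z *; apply: h4.
have [mD _ _ _] := hm; have [m'D _ _ _] := hm'; have [pD _ _ _] := hp.
case: (E_equiv) => _ _ t; apply: (t m p m') => //.
  exact: join_left ex hm hp.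
exact: (join_left yD y'D x'D ey (C _ _ _ hp) (C _ _ _ hm')).
Qed.

End JoinCongruence.

(** * The fibers of the weak order interval *)

Section Positions.

Variable n : nat.
Implicit Types (x y w : 'S_n) (a b u v : 'I_n).

Definition pos x a : nat := (x^-1)%g a.

Lemma pos_inj x a b : pos x a = pos x b -> a = b.
Proof. by move=> /val_inj; apply: perm_inj. Qed.

Lemma pos1 a : pos 1%g a = a.
Proof. by rewrite /pos invg1 perm1. Qed.

Lemma pos_tperm x a b u : pos (x * tperm a b)%g u = pos x (tperm a b u).
Proof. by rewrite /pos invMg tpermV permM. Qed.

Lemma ordinal_succ_mono_id (h : 'I_n -> 'I_n) :
  (forall i j : 'I_n, j = i.+1 :> nat -> h i < h j) -> forall i, h i = i.
Proof.
move=> mono.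
have A k (i j : 'I_n) : j = i + k :> nat -> h i + k <= h j.
  elim: k j => [|k IH] j e.
    by have -> : j = i by [apply: val_inj; rewrite /= e addn0]; rewrite addn0.
  have kn : i + k < n by have := ltn_ord j; clear -e; lia.
  have h1 := IH (Ordinal kn) erefl.
  have h2 : h (Ordinal kn) < h j by apply: mono; rewrite e addnS.
  by clear -h1 h2; lia.
move=> i; apply: val_inj => /=.
have n0 : 0 < n by have := ltn_ord i; clear; lia.
have ln : n.-1 < n by clear -n0; lia.
have := @A i (Ordinal n0) i erefl.
have := @A (n.-1 - i) i (Ordinal ln); have := ltn_ord (h (Ordinal ln)).
have := ltn_ord i; rewrite /=; clear -n0; lia.
Qed.

(** Otherwise reading the entries of [x] by their positions in [y] gives an increasing self-map of a
    finite ordinal, that is, the identity. *)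
Lemma consecutive_disagreement x y : x <> y ->
  exists a b, pos x b = (pos x a).+1 /\ pos y b < pos y a.
Proof.
move=> ne; apply: NNPP => nex; apply: ne.
have H := @ordinal_succ_mono_id (fun i => (y^-1)%g (x i)).
have {}H i : (y^-1)%g (x i) = i.
  apply: H => i' j' e; rewrite ltnNge; apply/negP=> le.
  apply: nex; exists (x i'), (x j'); rewrite /pos !permK; split=> //.
  rewrite ltn_neqAle le andbT; apply/negP=> /eqP/val_inj/perm_inj/perm_inj e2.
  by move: e; rewrite e2; clear; lia.
by apply/permP=> i; rewrite -{2}[i]H permKV.
Qed.

Lemma consecutive_swap x a b u v : pos x b = (pos x a).+1 ->
  pos x u < pos x v -> (u, v) <> (a, b) ->
  pos x (tperm a b u) < pos x (tperm a b v).
Proof.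
move=> e h ne.
have nva : v <> b -> pos x v <> pos x b by move=> nv /pos_inj.
have nub : u <> a -> pos x u <> pos x a by move=> nu /pos_inj.
case: (tpermP a b u) => [eu|eu|nu1 nu2]; case: (tpermP a b v) => [ev|ev|nv1 nv2];
  rewrite ?eu ?ev in h ne nva nub *; try (clear -h e; lia).
- by case: ne.
- by have := nva nv2; clear -h e; lia.
- by have := nub nu1; clear -h e; lia.
Qed.

(** The Kendall tau distance: each unordered pair is counted once, in the order it has in [x]. *)
Definition disagreements x y : nat :=
  #|[set p : 'I_n * 'I_n | (pos x p.1 < pos x p.2) && (pos y p.2 < pos y p.1)]|.

Lemma disagreements_swap x y a b : pos x b = (pos x a).+1 -> pos y b < pos y a ->
  disagreements (x * tperm a b)%g y < disagreements x y.
Proof.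
move=> e h; apply: proper_card; apply/properP; split.
  apply/subsetP=> -[u v]; rewrite !inE /= !pos_tperm => /andP[h1 h2].
  rewrite h2 andbT.
  have [//|h3|h3] := ltngtP (pos x u) (pos x v); last first.
    by move: h1; rewrite (pos_inj h3) ltnn.
  have [[e1 e2]|ne] := classic ((v, u) = (a, b)).
    by move: h2; rewrite e1 e2; move: h; clear; lia.
  by have := consecutive_swap e h3 ne; move: h1; clear; lia.
exists (a, b); rewrite !inE /= ?pos_tperm ?tpermL ?tpermR e ?h; by clear; lia.
Qed.

Lemma weak_leP x y :
  reflect (forall a b, a < b -> pos x b < pos x a -> pos y b < pos y a) (weak_le x y).
Proof.
apply: (iffP idP) => [/'forall_forallP h a b ab hx|h].
  by have := h a b; rewrite /inversion ab -/(pos x a) -/(pos x b) hx.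
apply/'forall_forallP=> a b; apply/implyP=> /andP[ab hx].
by rewrite /inversion ab; apply: h.
Qed.

(** The Boolean [s] selects the weak order or its dual; going up means exchanging consecutive
    entries whose labels stand in the order [label_lt s]. *)
Definition label_lt (s : bool) a b := if s then a < b else b < a.
Definition weak_les (s : bool) x y := if s then weak_le x y else weak_le y x.

Lemma weak_lesP s x y :
  reflect (forall a b, label_lt s a b -> pos x b < pos x a -> pos y b < pos y a)
          (weak_les s x y).
Proof.
case: s => /=; first exact: weak_leP.
apply: (iffP (weak_leP _ _)) => h a b ab hx; rewrite ltnNge; apply/negP => hy.
all: have ne : pos x a <> pos x b by move=> /pos_inj e; move: ab; rewrite e ltnn.
all: have ne2 : pos y a <> pos y b by move=> /pos_inj e; move: ab; rewrite e ltnn.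
all: have := h b a ab; clear -hx hy ne ne2; lia.
Qed.

Lemma weak_le_refl : reflexive (@weak_le n).
Proof. by move=> x; apply/weak_leP. Qed.

Lemma weak_le_trans : transitive (@weak_le n).
Proof.
by move=> y x z /weak_leP h1 /weak_leP h2; apply/weak_leP=> a b ab h; apply: h2 (h1 _ _ ab h).
Qed.

Lemma weak_le_anti : antisymmetric (@weak_le n).
Proof.
move=> x y /andP[/weak_leP h1 /weak_leP h2]; apply: NNPP => /consecutive_disagreement.
move=> [a [b [e h]]]; case: (ltngtP a b) => ab.
- by have := h2 _ _ ab h; rewrite e; clear; lia.
- have ne : pos x b > pos x a by rewrite e.
  by have := h1 _ _ ab ne; move: h; clear; lia.
- by move: h; rewrite (val_inj ab) ltnn.
Qed.

Lemma weak_les_swap s x y a b : weak_les s x y -> pos x b = (pos x a).+1 ->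
  pos y b < pos y a -> weak_les s (x * tperm a b)%g y.
Proof.
move=> /weak_lesP h e hy; apply/weak_lesP=> u v uv; rewrite !pos_tperm => h2.
case: (ltngtP (pos x v) (pos x u)) => h3; first exact: h uv h3.
  have [[-> ->]//|ne] := classic ((u, v) = (a, b)).
  by have := consecutive_swap e h3 ne; move: h2; clear; lia.
by move: h2; rewrite (pos_inj h3) ltnn.
Qed.

Lemma weak_les_step s x a b : label_lt s a b -> pos x b = (pos x a).+1 ->
  weak_les s x (x * tperm a b)%g.
Proof.
move=> ab e; apply/weak_lesP=> u v uv h; rewrite !pos_tperm.
apply: (consecutive_swap e h) => -[e1 e2]; move: uv ab; rewrite /label_lt e1 e2.
by case: s; clear; lia.
Qed.

Lemma weak_le_trans_s s : transitive (weak_les s).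
Proof.
case: s => y x z /=; first exact: weak_le_trans.
by move=> h1 h2; apply: weak_le_trans h2 h1.
Qed.

Variable w : 'S_n.
Local Notation D := (weak_interval 1%g w).

Lemma weak_intervalP x :
  reflect (forall a b, a < b -> pos x b < pos x a -> pos w b < pos w a) (x \in D).
Proof.
rewrite inE; apply: (iffP andP) => [[_ /weak_leP //]|h]; split; last exact/weak_leP.
by apply/weak_leP=> a b ab; rewrite !pos1; move: ab; clear; lia.
Qed.

(** Symmetric in the two labels: these are the pairs that may be exchanged inside the interval. *)
Definition inverted (a b : 'I_n) : bool :=
  ((a < b) && (pos w b < pos w a)) || ((b < a) && (pos w a < pos w b)).

Lemma inverted_of_disagreement x y a b : x \in D -> y \in D ->
  pos x a < pos x b -> pos y b < pos y a -> inverted a b.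
Proof.
move=> /weak_intervalP hx /weak_intervalP hy h1 h2.
rewrite /inverted; case: (ltngtP a b) => ab /=.
- by rewrite hy.
- by rewrite hx.
- by move: h1; rewrite (val_inj ab) ltnn.
Qed.

Lemma inverted_swap x a b : x \in D -> pos x b = (pos x a).+1 -> inverted a b ->
  (x * tperm a b)%g \in D.
Proof.
move=> /weak_intervalP hx e inv; apply/weak_intervalP=> u v uv; rewrite !pos_tperm => h.
case: (ltngtP (pos x v) (pos x u)) => h3; first exact: hx uv h3.
  have [[e1 e2]|ne] := classic ((u, v) = (a, b)).
    by move: inv uv; rewrite /inverted e1 e2; clear; lia.
  by have := consecutive_swap e h3 ne; move: h; clear; lia.
by move: h; rewrite (pos_inj h3) ltnn.
Qed.

End Positions.

Section Fibers.

Variables (N : net).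
Local Notation n := (width N).
Variable w : 'S_(width N).
Local Notation D := (weak_interval 1%g w).
Implicit Types (x y : 'S_(width N)) (a b u v : 'I_(width N)).

(** The virtual labels of the network are placed after all pipes, so that [position_swap] holds for
    all natural numbers. *)
Definition position x (i : nat) : nat := if insub i is Some o then pos x o else i.

Lemma positionE x a : position x a = pos x a.
Proof. by rewrite /position valK. Qed.

Lemma position_lt x i (h : i < n) : position x i = pos x (Ordinal h).
Proof. by rewrite -positionE. Qed.

Lemma position_ge x i : n <= i -> position x i = i.
Proof. by move=> h; rewrite /position insubF // ltnNge h. Qed.

Lemma position_tperm x a b i :
  position (x * tperm a b)%g i = position x (swap a b i).
Proof.
have [h|h] := ltnP i n; last first.
  rewrite position_ge // swapD ?position_ge //.
    by have := ltn_ord a; clear -h; lia.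
  by have := ltn_ord b; clear -h; lia.
rewrite position_lt pos_tperm; case: tpermP => [<-|<-|n1 n2].
- by rewrite swapL positionE.
- by rewrite swapR positionE.
- rewrite swapD ?position_lt //; [move=> e; apply: n1|move=> e; apply: n2];
  exact: val_inj.
Qed.

Definition exit_level (i : nat) : nat := (position w i).+1.

(** Only the contact arcs are required to be respected; the noninversion arcs amount to membership
    of [x] in the interval. *)
Definition fiber x (X : nat -> nat -> bool) : Prop :=
  realizes N exit_level X /\ compatible N X (position x).

Lemma position_swap x a b p q : pos x b = (pos x a).+1 ->
  position x p < position x q -> (p, q) <> (a : nat, b : nat) ->
  position x (swap a b p) < position x (swap a b q).
Proof.
move=> e h ne; rewrite -!position_tperm.
have [hp|hp] := ltnP p n; have [hq|hq] := ltnP q n.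
- rewrite !position_lt !pos_tperm in h *; apply: consecutive_swap => // -[e1 e2].
  by apply: ne; rewrite -e1 -e2.
- rewrite (position_ge _ hq) position_lt; exact: leq_trans (ltn_ord _) hq.
- move: h; rewrite (position_ge _ hp) position_lt.
  by have := ltn_ord ((x^-1)%g (Ordinal hq)); rewrite /pos; clear -hp; lia.
- by move: h; rewrite !position_ge.
Qed.

Definition no_contact X a b := forall j, ~~ contact N X a b j.

Lemma fiber_keep x X a b : fiber x X -> pos x b = (pos x a).+1 -> no_contact X a b ->
  fiber (x * tperm a b)%g X.
Proof.
move=> [rX cX] e nc; split=> // p q j h; rewrite !position_tperm.
apply: position_swap => //; first exact: cX h.
by move=> [e1 e2]; rewrite e1 e2 (negbTE (nc j)) in h.
Qed.

Lemma fiber_no_contact x X a b : fiber x X -> pos x a < pos x b -> no_contact X b a.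
Proof.
move=> [_ cX] h j; apply/negP=> /cX; rewrite !positionE; move: h; clear; lia.
Qed.

(** An ascent calls for [step_up]. For a descent the target permutation is the lower one and plays
    the role of [f] in [step_down]. *)
Lemma fiber_move x X a b : fiber x X -> pos x b = (pos x a).+1 -> inverted w a b ->
  exists Y, fiber (x * tperm a b)%g Y /\ swapped_contacts N a b X Y.
Proof.
move=> [rX cX] e /orP[|] /andP[ab wab].
- have fin_ba : exit_level b < exit_level a by rewrite /exit_level !positionE.
  have fab : position x a < position x b by rewrite !positionE e.
  have [Y [rY cY s]] :=
    step_up ab (ltn_ord b) fin_ba (fun p q => @position_swap x a b p q e) fab rX cX.
  by exists Y; split=> //; split=> // p q j /cY; rewrite !position_tperm.
- pose y := (x * tperm a b)%g.
  have pa : pos y a = (pos y b).+1 by rewrite !pos_tperm tpermL tpermR.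
  have exy i : position x i = position y (swap b a i).
    rewrite /y position_tperm; case: (eqVneq i a) => [->|/eqP ia].
      by rewrite swapR swapR.
    case: (eqVneq i b) => [->|/eqP ib]; first by rewrite swapL swapL.
    by rewrite !swapD.
  have fba : position y b < position y a by rewrite !positionE pa.
  have cX' : compatible N X (fun i => position y (swap b a i)).
    by move=> p q j /cX; rewrite !exy.
  have [Y [rY cY s _]] :=
    step_down ab (fun p q => @position_swap y b a p q pa) fba rX cX'.
  exists Y; split=> // p q j /s [[h|h]|h|h].
  + by constructor 1; right.
  + by constructor 1; left.
  + by constructor 2.
  + constructor 3; move: h.
    have sw i : swap b a i = swap a b i.
      case: (eqVneq i a) => [->|/eqP ia]; first by rewrite swapL swapR.
      case: (eqVneq i b) => [->|/eqP ib]; first by rewrite swapL swapR.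
      by rewrite !swapD.
    by rewrite !sw.
Qed.

Hypothesis realizable : exists X, realizes N exit_level X.

(** Induction on the number of inversions: undoing a descent stays in the interval, from where
    existence climbs back by [fiber_move] and uniqueness by [unique_up]. *)
Lemma fiber_exists_unique x : x \in D -> (exists X, fiber x X) /\
  forall X Y, fiber x X -> fiber x Y -> same_crossings N X Y.
Proof.
have [k hk] : exists k, disagreements x 1%g < k by exists (disagreements x 1%g).+1.
elim: k x hk => // k IH x hk xD.
have [->|/eqP/consecutive_disagreement[a [b [e]]]] := eqVneq x 1%g.
  have p1 i : position 1 i = i.
    by rewrite /position; case: insubP => //= o _ <-; rewrite pos1.
  split.
    have [X rX] := realizable; have [Y [rY cY]] := exists_compatible_id rX.
    by exists Y; split=> // p q j /cY; rewrite !p1.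
  move=> X Y [rX cX] [rY cY]; apply: (unique_compatible_id rX rY).
    by move=> p q j /cX; rewrite !p1.
  by move=> p q j /cY; rewrite !p1.
rewrite !pos1 => ba.
pose y := (x * tperm a b)%g.
have wba : pos w a < pos w b.
  by move/weak_intervalP: xD; apply; rewrite ?e.
have inv : inverted w a b by rewrite /inverted ba wba orbT.
have yD : y \in D by apply: inverted_swap.
have hd : disagreements y 1%g < disagreements x 1%g.
  by apply: disagreements_swap; rewrite ?pos1.
have [[Y fY] uY] := IH y (leq_trans hd hk) yD.
have pa : pos y a = (pos y b).+1 by rewrite !pos_tperm tpermL tpermR.
have xE : x = (y * tperm b a)%g by rewrite /y tpermC -mulgA tperm2 mulg1.
split.
  have inv' : inverted w b a by rewrite /inverted ba wba.
  by have [X [fX _]] := fiber_move fY pa inv'; exists X; rewrite xE.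
move=> X Z [rX cX] [rZ cZ].
have C U : compatible N U (position x) -> compatible N U (fun i => position y (swap b a i)).
  by move=> cU p q j /cU; rewrite {1 2}xE !position_tperm.
have fba : position y b < position y a by rewrite !positionE pa.
apply: (unique_up ba (fun p q => @position_swap y b a p q pa) fba _ rX rZ (C _ cX) (C _ cZ)).
by move=> X' Y' *; apply: uY; split.
Qed.

End Fibers.

(** * Squares and hexagons of the weak order *)

Section Congruence.

Variables (N : net).
Local Notation n := (width N).
Variable w : 'S_(width N).
Local Notation D := (weak_interval 1%g w).
Implicit Types (x y z m h : 'S_(width N)) (a b c d p q r u v : 'I_(width N)).
Hypothesis realizable : exists X, realizes N (exit_level w) X.

Definition same_fiber x y : Prop :=
  [/\ x \in D, y \in D & exists X, fiber w x X /\ fiber w y X].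

Lemma swap_tperm a b u : swap a b u = tperm a b u.
Proof.
case: tpermP => [->|->|n1 n2]; rewrite ?swapL ?swapR //.
by rewrite swapD // => /val_inj.
Qed.

Lemma fiber_same x X Y : fiber w x X -> fiber w x Y -> x \in D ->
  forall y, fiber w y Y -> fiber w y X.
Proof.
move=> fX fY xD y [rY cY]; have [rX _] := fX; split=> // p q j.
have [_ u] := fiber_exists_unique realizable xD.
by rewrite (same_contact (u _ _ fX fY)); apply: cY.
Qed.

Lemma same_fiber_equivalence : equivalence_on D same_fiber.
Proof.
split=> [x xD|x y xD yD [_ _ [X [h1 h2]]]|x y z xD yD zD [_ _ [X [h1 h2]]] [_ _ [Y [h3 h4]]]].
- by have [[X fX] _] := fiber_exists_unique realizable xD; split=> //; exists X.
- by split=> //; exists X.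
- by split=> //; exists X; split=> //; apply: (fiber_same h2 h3).
Qed.

Lemma same_fiber_no_contact x X a b : fiber w x X -> pos x b = (pos x a).+1 ->
  same_fiber x (x * tperm a b)%g -> no_contact X a b.
Proof.
move=> fX e [xD yD [Y [fY fY']]]; have fy := fiber_same fX fY xD fY'.
by apply: (fiber_no_contact fy); rewrite !pos_tperm tpermL tpermR e.
Qed.

Lemma no_contact_move X Y c d u v : swapped_contacts N c d X Y ->
    ~ (u = c /\ v = d) -> ~ (u = d /\ v = c) ->
    no_contact X u v -> no_contact X (tperm c d u) (tperm c d v) ->
  no_contact Y u v.
Proof.
move=> s n1 n2 h1 h2 j; apply/negP=> /s[[[e1 e2]|[e1 e2]]|h|].
- by apply: n1; split; apply: val_inj.
- by apply: n2; split; apply: val_inj.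
- by have := h1 j; rewrite h.
- by rewrite !swap_tperm => h; have := h2 j; rewrite h.
Qed.

(** The exits of the three pipes are in the order opposite to their labels, so [contact_between]
    applies with the positions in [x] as [f]. *)
Lemma no_contact_between x X s u b v : fiber w x X -> pos x u < pos x b < pos x v ->
  label_lt s u b -> label_lt s b v -> inverted w u b -> inverted w b v ->
  no_contact X u v.
Proof.
move=> [[red hX] cX] px ub bv i1 i2 j; apply/negP=> h.
have := contact_between red cX h (ltn_ord b); rewrite /= !hX // /exit_level !positionE.
move: px ub bv i1 i2; rewrite /label_lt /inverted; case: s; clear; lia.
Qed.

Definition weak_step s x y : Prop := exists a b,
  [/\ label_lt s a b, pos x b = (pos x a).+1, inverted w a b & y = (x * tperm a b)%g].

Lemma weak_step_le s x y : weak_step s x y -> weak_les s x y.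
Proof. by move=> [a [b [ab e _ ->]]]; apply: weak_les_step. Qed.

Definition top s : 'S_(width N) := if s then w else 1%g.
Definition bottom s : 'S_(width N) := if s then 1%g else w.

Lemma weak_step_rank s x y : weak_step s x y ->
  disagreements y (top s) < disagreements x (top s).
Proof.
move=> [a [b [ab e i ->]]]; apply: disagreements_swap => //.
by move: ab i; rewrite /top /label_lt /inverted; case: s; rewrite ?pos1 //; clear; lia.
Qed.

Lemma weak_step_exists s x y : x \in D -> y \in D -> weak_les s x y -> x <> y ->
  exists t, [/\ t \in D, weak_step s x t & weak_les s t y].
Proof.
move=> xD yD le ne; have [a [b [e h]]] := consecutive_disagreement ne.
have i : inverted w a b by apply: (inverted_of_disagreement xD yD); rewrite ?e.
exists (x * tperm a b)%g; split.
- exact: inverted_swap.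
- exists a, b; split=> //.
  case: (ltngtP a b) => ab; last by move: h; rewrite (val_inj ab) ltnn.
  + case: s le => // /weak_lesP le; have := le a b; rewrite /label_lt.
    have := le b a; rewrite /label_lt e. move: h; clear -ab; lia.
  + case: s le => // /weak_lesP le; have := le b a; rewrite /label_lt e.
    by move: h; clear -ab; lia.
- exact: weak_les_swap.
Qed.

Lemma same_fiber_step s x y : x \in D -> y \in D -> same_fiber x y -> x <> y ->
  exists t, [/\ t \in D, same_fiber x t, weak_step s x t \/ weak_step s t x &
                disagreements t y < disagreements x y].
Proof.
move=> xD yD [_ _ [X [fx fy]]] ne; have [a [b [e h]]] := consecutive_disagreement ne.
have i : inverted w a b by apply: (inverted_of_disagreement xD yD); rewrite ?e.
have tD := inverted_swap xD e i.
exists (x * tperm a b)%g; split=> //.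
- by split=> //; exists X; split=> //; apply: fiber_keep => //; apply: (fiber_no_contact fy).
- have [ab|ab] := boolP (label_lt s a b); first by left; exists a, b.
  right; exists b, a; split.
  + have : (a : nat) <> b by move=> /val_inj e2; move: h; rewrite e2 ltnn.
    by move: ab; rewrite /label_lt; case: s; clear; lia.
  + by rewrite !pos_tperm tpermL tpermR.
  + by move: i; rewrite /inverted orbC.
  + by rewrite (tpermC b) -mulgA tperm2 mulg1.
- exact: disagreements_swap.
Qed.

Local Notation E := same_fiber.
Local Notation chain s := (clos_refl_trans_1n _ (contracted D (weak_step s) E)).

Lemma chain_step s x y : x \in D -> y \in D -> weak_step s x y -> same_fiber x y ->
  forall z, chain s y z -> chain s x z.
Proof. by move=> *; apply: rt1n_trans; first by split; eauto. Qed.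

Lemma tperm_commute a b c d : [/\ c != a, d != a, c != b & d != b] ->
  (tperm a b * tperm c d = tperm c d * tperm a b)%g.
Proof. by case=> *; rewrite conjgC tpermJ !tpermD. Qed.

Lemma tperm_braid p q r : p != q -> r != q -> p != r ->
  (tperm q r * tperm p r * tperm p q = tperm p r)%g.
Proof.
by move=> pq rq pr; rewrite (conjgC (tperm q r)) tpermJ tpermR tpermD // (tpermC q) -mulgA tperm2 mulg1.
Qed.

Lemma pos_neq x a b k : pos x b = pos x a + k.+1 -> a != b.
Proof. by move=> e; apply/eqP=> e2; move: e; rewrite e2; clear; lia. Qed.

Lemma is_join_sym s y z m : is_join D (weak_les s) y z m -> is_join D (weak_les s) z y m.
Proof. by case=> h1 h2 h3 h4; split=> // h hD le1 le2; apply: h4. Qed.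

Lemma weak_les_inverted s x h a b : label_lt s a b -> pos x b = (pos x a).+1 ->
  weak_les s (x * tperm a b)%g h -> pos h b < pos h a.
Proof.
by move=> ab e /weak_lesP le; apply: le => //; rewrite !pos_tperm tpermL tpermR e.
Qed.

(** Exchanging [c] and [d] renames neither [a] nor [b], so their lack of contact persists. *)
Lemma square_join s x a b c d : x \in D ->
    label_lt s a b -> pos x b = (pos x a).+1 -> inverted w a b ->
    label_lt s c d -> pos x d = (pos x c).+1 -> inverted w c d ->
    [/\ c != a, d != a, c != b & d != b] ->
  let y := (x * tperm a b)%g in let z := (x * tperm c d)%g in
  exists m, is_join D (weak_les s) y z m /\ (E x y -> chain s z m).
Proof.
move=> xD ab e1 i1 cd e2 i2 ne y z; have [n1 n2 n3 n4] := ne.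
have zD : z \in D by apply: inverted_swap.
pose m := (z * tperm a b)%g.
have mE : m = (y * tperm c d)%g by rewrite /m /z /y -!mulgA (tperm_commute ne).
have ez : pos z b = (pos z a).+1 by rewrite !pos_tperm !tpermD.
have ey : pos y d = (pos y c).+1 by rewrite !pos_tperm !tpermD // eq_sym.
have mD : m \in D by apply: inverted_swap.
exists m; split.
  split=> // [||h hD yh zh].
  - by rewrite mE; apply: weak_les_step.
  - exact: weak_les_step.
  - by apply: weak_les_swap => //; apply: (weak_les_inverted ab e1 yh).
move=> xy; apply: (chain_step zD mD _ _ (rt1n_refl _ _ _)); first by exists a, b.
have [[X fX] _] := fiber_exists_unique realizable xD.
have nc := same_fiber_no_contact fX e1 xy.
have [Y [fY sY]] := fiber_move fX e2 i2.
split=> //; exists Y; split=> //; apply: fiber_keep => //.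
apply: (no_contact_move sY) => //; last by rewrite !tpermD.
- by case=> e _; rewrite e eqxx in n1.
- by case=> e _; rewrite e eqxx in n2.
Qed.

(** Exchanging [q] and [r] interchanges the pairs [p, q] and [p, r]. When neither pair has a contact
    below, neither has one afterwards, and the same tiling lies over [z], [z1] and [m]. The other
    side uses the pairs [q, r] and [p, r]. *)
Lemma hexagon_join s x p q r : x \in D ->
    label_lt s p q -> pos x q = (pos x p).+1 -> inverted w p q ->
    label_lt s q r -> pos x r = (pos x q).+1 -> inverted w q r ->
  let y := (x * tperm p q)%g in let z := (x * tperm q r)%g in
  exists m, [/\ is_join D (weak_les s) y z m, E x y -> chain s z m & E x z -> chain s y m].
Proof.
move=> xD pq e1 i1 qr e2 i2 y z.
have npq : p != q by apply: (@pos_neq x _ _ 0); rewrite e1 addn1.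
have nqr : q != r by apply: (@pos_neq x _ _ 0); rewrite e2 addn1.
have npr : p != r by apply: (@pos_neq x _ _ 1); rewrite e2 e1 addn2.
have nqp : q != p by rewrite eq_sym.
have nrq : r != q by rewrite eq_sym.
have nrp : r != p by rewrite eq_sym.
have pr : label_lt s p r by move: pq qr; rewrite /label_lt; case: s; clear; lia.
have i3 : inverted w p r.
  by clear pr; move: pq qr i1 i2; rewrite /label_lt /inverted; case: s; clear; lia.
have tE := (tpermL, tpermR, tpermD).
pose z1 := (z * tperm p r)%g; pose y1 := (y * tperm p r)%g.
pose m := (z1 * tperm p q)%g.
have mE : m = (y1 * tperm q r)%g.
  rewrite /m /y1 /z1 /y /z -!mulgA; congr (_ * _)%g.
  rewrite mulgA tperm_braid // mulgA (tpermC p q) (conjgC (tperm q p)) tpermJ tpermL tpermD //.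
  by rewrite -mulgA tperm2 mulg1.
have yD : y \in D by apply: inverted_swap.
have zD : z \in D by apply: inverted_swap.
have ez : pos z r = (pos z p).+1 by rewrite !pos_tperm tpermR tpermD // e1.
have z1D : z1 \in D by apply: inverted_swap.
have ez1 : pos z1 q = (pos z1 p).+1.
  by rewrite !pos_tperm tpermL (@tpermD _ p r q) // tpermL tpermR e2.
have ey : pos y r = (pos y p).+1 by rewrite !pos_tperm tpermL tpermD // e2.
have y1D : y1 \in D by apply: inverted_swap.
have ey1 : pos y1 r = (pos y1 q).+1.
  by rewrite !pos_tperm tpermR (@tpermD _ p r q) // tpermL tpermR e1.
have mD : m \in D by apply: inverted_swap.
have [[X fX] _] := fiber_exists_unique realizable xD.
have px : pos x p < pos x q < pos x r by rewrite e2 e1; clear; lia.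
have npr' : no_contact X p r by apply: (no_contact_between fX px pq qr).
exists m; split.
- split=> // [||h hD yh zh].
  + by rewrite mE; apply: (@weak_le_trans_s _ s y1); apply: weak_les_step.
  + by apply: (@weak_le_trans_s _ s z1); apply: weak_les_step.
  + have h1 := weak_les_inverted pq e1 yh; have h2 := weak_les_inverted qr e2 zh.
    have h3 : pos h r < pos h p by move: h1 h2; clear; lia.
    by apply: weak_les_swap => //; apply: weak_les_swap.
- move=> xy; have nc := same_fiber_no_contact fX e1 xy.
  have [Y [fY sY]] := fiber_move fX e2 i2.
  have nY1 : no_contact Y p r.
    apply: (no_contact_move sY) => //; try by case=> /eqP; rewrite ?(negbTE npq) ?(negbTE npr).
    by rewrite tpermR tpermD.
  have nY2 : no_contact Y p q.
    apply: (no_contact_move sY) => //; try by case=> /eqP; rewrite ?(negbTE npq) ?(negbTE npr).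
    by rewrite tpermL tpermD.
  have fz1 : fiber w z1 Y by apply: fiber_keep.
  apply: (chain_step zD z1D); first by exists p, r.
    by split=> //; exists Y.
  apply: (chain_step z1D mD _ _ (rt1n_refl _ _ _)); first by exists p, q.
  by split=> //; exists Y; split=> //; apply: fiber_keep.
- move=> xz; have nc := same_fiber_no_contact fX e2 xz.
  have [Y [fY sY]] := fiber_move fX e1 i1.
  have nY1 : no_contact Y p r.
    apply: (no_contact_move sY) => //;
      try by case=> _ /eqP; rewrite ?(negbTE nrq) ?(negbTE nrp).
    by rewrite tpermL tpermD.
  have nY2 : no_contact Y q r.
    apply: (no_contact_move sY) => //;
      try by case=> _ /eqP; rewrite ?(negbTE nrq) ?(negbTE nrp).
    by rewrite tpermR tpermD.
  have fy1 : fiber w y1 Y by apply: fiber_keep.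
  apply: (chain_step yD y1D); first by exists p, r.
    by split=> //; exists Y.
  apply: (chain_step y1D mD _ _ (rt1n_refl _ _ _)); first by rewrite mE; exists q, r.
  by split=> //; exists Y; split=> //; rewrite mE; apply: fiber_keep.
Qed.

Lemma weak_step_join s x y z : x \in D -> y \in D -> z \in D ->
    weak_step s x y -> weak_step s x z -> y <> z ->
  exists m, is_join D (weak_les s) y z m /\ (E x y -> chain s z m).
Proof.
move=> xD yD zD [a [b [ab e1 i1 ->]]] [c [d [cd e2 i2 ->]]] ne.
have [ac|nac] := eqVneq c a.
  by case: ne; congr (_ * tperm _ _)%g => //; apply: (@pos_inj _ x); rewrite e1 e2 ac.
have [cb|ncb] := eqVneq c b.
  rewrite cb in cd e2 i2 *.
  by have [m [h1 h2 _]] := hexagon_join xD ab e1 i1 cd e2 i2; exists m.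
have [da|nda] := eqVneq d a.
  rewrite da in cd e2 i2 *.
  have [m [h1 _ h2]] := hexagon_join xD cd e2 i2 ab e1 i1.
  by exists m; split=> //; apply: is_join_sym.
apply: square_join => //; split=> //.
by apply/eqP=> e; move: nac; rewrite (_ : c = a) ?eqxx //; apply: (@pos_inj _ x);
  apply: succn_inj; rewrite -e1 -e2 e.
Qed.

Lemma same_fiber_congruence : lattice_congruence D (@weak_le (width N)) same_fiber.
Proof.
have lr k s : reflexive (@weak_les k s) by move=> x; case: s; apply: weak_le_refl.
have lt k s : transitive (@weak_les k s) by move=> y x z; apply: weak_le_trans_s.
have la k s : antisymmetric (@weak_les k s).
  by case: s => x y /= h; apply: weak_le_anti; rewrite ?h // andbC.
have idD : 1%g \in D by apply/weak_intervalP=> a b ab; rewrite !pos1; move: ab; clear; lia.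
have wD : w \in D by apply/weak_intervalP.
have bD s : bottom s \in D by case: s.
have bl s x : x \in D -> weak_les s (bottom s) x.
  by rewrite inE => /andP[]; case: s.
have J s x y (xD : x \in D) (yD : y \in D) : exists m, is_join D (weak_les s) x y m :=
  join_exists (@lr n s) (@lt n s) (bD s) (@bl s) (@weak_step_exists s) (@weak_step_rank s)
    (@weak_step_join s) xD yD.
have K s : compatible_on D (is_join D (weak_les s)) E :=
  join_compatible (@lr n s) (@lt n s) (@la n s) same_fiber_equivalence (bD s) (@bl s)
    (@weak_step_exists s) (@weak_step_le s) (@weak_step_rank s) (@weak_step_join s)
    (@same_fiber_step s).
split; [split| | |].
- by move=> x _; apply: weak_le_refl.
- by move=> x y _ _; apply: weak_le_anti.
- by move=> y x z _ _ _; apply: weak_le_trans.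
(* A join for [weak_les false] is by conversion a meet for [weak_le]. *)
- exact: (J false).
- exact: (J true).
- exact: same_fiber_equivalence.
- exact: (K false).
- exact: (K true).
Qed.

End Congruence.

(** * Alternating shapes as networks *)

Section Grid.

Import Order.TTheory GRing.Theory Num.Theory.
Local Open Scope ring_scope.

Definition diag (p : point) : int := p.1 - p.2.
Definition time (p : point) : int := p.1 + p.2.
(** The summand for horizontal edges gives the west and north sides of a cell on diagonal [k] the
    level [k], and its south and east sides the level [k + 1]. *)
Definition level (e : edge) : int := diag e.2 + e.1%:Z.

Lemma point_eq (p q : point) : diag p = diag q -> time p = time q -> p = q.
Proof.
by case: p q => [x y] [x' y']; rewrite /diag /time /= => h1 h2; congr pair; lia.
Qed.

Lemma edge_eq (e e' : edge) : level e = level e' -> time e.2 = time e'.2 -> e = e'.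
Proof.
case: e e' => [b [x y]] [b' [x' y']]; rewrite /level /diag /time /= => h1 h2.
have eb : b = b' by case: b h1; case: b'; lia.
by rewrite eb in h1 *; congr (_, (_, _)); lia.
Qed.

Lemma diag_move p d : is_SE d -> diag (move p d) = diag p + 1.
Proof. by case: d => // _; rewrite /diag /=; lia. Qed.

Lemma time_move p d : is_SE d -> time (move p d) = time p + 1 \/ time p = time (move p d) + 1.
Proof. by case: d => // _; rewrite /time /=; lia. Qed.

Lemma level_step p d : is_SE d -> level (step_edge p d) = diag p + 1.
Proof. by case: d => // _; rewrite /level /diag /=; lia. Qed.

Lemma time_step p d : is_SE d -> time (step_edge p d).2 = Num.min (time p) (time (move p d)).
Proof. by case: d => // _; rewrite /time /=; lia. Qed.

Lemma vertexS p w k : (k < size w)%N -> vertex p w k.+1 = move (vertex p w k) (nth South w k).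
Proof. by move=> h; rewrite /vertex (take_nth South h) foldl_rcons. Qed.

Lemma nth_SE w k : all is_SE w -> is_SE (nth South w k).
Proof.
move=> h; have [hk|hk] := ltnP k (size w); last by rewrite nth_default.
by elim: w k h hk => // d w IH [|k] /= /andP[h1 h2] hk //; apply: IH.
Qed.

Lemma diag_vertex p w k : all is_SE w -> (k <= size w)%N -> diag (vertex p w k) = diag p + k%:Z.
Proof.
move=> h; elim: k => [|k IH] hk; first by rewrite /vertex take0 /=; lia.
by rewrite vertexS // diag_move ?nth_SE // IH 1?ltnW //; lia.
Qed.

Lemma mem_path_edges p w e : reflect
  (exists2 i, (i < size w)%N & e = step_edge (vertex p w i) (nth South w i))
  (e \in path_edges p w).
Proof.
elim: w p => [|d w IH] p /=; first by constructor=> -[].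
rewrite inE; apply: (iffP orP) => [[/eqP eE|/IH[i hi eE]]|[[|i] hi eE]].
- by exists 0.
- by exists i.+1.
- by left; apply/eqP.
- by right; apply/IH; exists i.
Qed.

Lemma endpoint_NE p k : endpoint p (NE_stair k) = (p.1 + k%:Z, p.2 + k%:Z).
Proof.
elim: k p => [|k IH] p; first by case: p => x y; rewrite /= !addr0.
rewrite [LHS](IH (east_of (north_of p))) /=; congr pair; lia.
Qed.

Lemma endpoint_EN p k : endpoint p (EN_stair k) = (p.1 + k%:Z, p.2 + k%:Z).
Proof.
elim: k p => [|k IH] p; first by case: p => x y; rewrite /= !addr0.
rewrite [LHS](IH (north_of (east_of p))) /=; congr pair; lia.
Qed.

Lemma level_NE p k e : e \in path_edges p (NE_stair k) -> level e = diag p.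
Proof.
elim: k p => [|k IH] p //=; rewrite !inE => /orP[/eqP->|/orP[/eqP->|/IH->]];
  rewrite /level /diag /=; lia.
Qed.

Lemma level_EN p k e : e \in path_edges p (EN_stair k) -> level e = diag p + 1.
Proof.
elim: k p => [|k IH] p //=; rewrite !inE => /orP[/eqP->|/orP[/eqP->|/IH->]];
  rewrite /level /diag /=; lia.
Qed.

(** The starting path may descend to time [-n]. The shift makes times natural numbers and is even,
    so the network of a shape has offset 0. *)
Definition clock (n : nat) (p : point) : int := time p + n.*2%:Z.

(* The edges of a fixed level form a zigzag, along which membership of the
   entered cell changes exactly at boundary edges. *)
Definition succ_edge (e : edge) : edge :=
  if e.1 then vedge (east_of e.2) else hedge (north_of e.2).

Lemma level_succ e : level (succ_edge e) = level e.
Proof. by case: e => [[] p]; rewrite /level /diag /=; lia. Qed.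

Lemma clock_succ n e : clock n (succ_edge e).2 = clock n e.2 + 1.
Proof. by case: e => [[] p]; rewrite /clock /time /=; lia. Qed.

Section Shape.

Variables (n : nat) (F : alternating_shape n).

Let lower (k : nat) : point := vertex origin (start_path F) k.
Let upper (k : nat) : point := vertex (endpoint origin (NE_stair (nw_size F))) (end_path F) k.

Lemma diag_lower k : (k <= n)%N -> diag (lower k) = k%:Z.
Proof.
by move=> h; rewrite diag_vertex ?start_path_SE ?size_tuple //; rewrite /diag /=; lia.
Qed.

Lemma diag_upper k : (k <= n)%N -> diag (upper k) = k%:Z.
Proof.
by move=> h; rewrite diag_vertex ?end_path_SE ?size_tuple // endpoint_NE /diag /=; lia.
Qed.

Lemma lowerS k : (k < n)%N -> lower k.+1 = move (lower k) (nth South (start_path F) k).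
Proof. by move=> h; apply: vertexS; rewrite size_tuple. Qed.

Lemma upperS k : (k < n)%N -> upper k.+1 = move (upper k) (nth South (end_path F) k).
Proof. by move=> h; apply: vertexS; rewrite size_tuple. Qed.

Lemma time_lowerS k : (k < n)%N ->
  time (lower k.+1) = time (lower k) + 1 \/ time (lower k) = time (lower k.+1) + 1.
Proof. by move=> h; rewrite lowerS //; apply: time_move; rewrite nth_SE ?start_path_SE. Qed.

Lemma time_upperS k : (k < n)%N ->
  time (upper k.+1) = time (upper k) + 1 \/ time (upper k) = time (upper k.+1) + 1.
Proof. by move=> h; rewrite upperS //; apply: time_move; rewrite nth_SE ?end_path_SE. Qed.

Lemma time_lower0 : time (lower 0) = 0.
Proof. by rewrite /lower /vertex take0. Qed.

Lemma time_upper0 : time (upper 0) = (nw_size F).*2%:Z.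
Proof. by rewrite /upper /vertex take0 /= endpoint_NE /time /=; lia. Qed.

Lemma time_lower_ge k : (k <= n)%N -> - k%:Z <= time (lower k).
Proof.
elim: k => [|k IH] h; first by rewrite time_lower0.
have := IH (ltnW h); have := time_lowerS h; lia.
Qed.

Lemma time_upper_bounds k : (k <= n)%N ->
  - k%:Z <= time (upper k) <= (nw_size F).*2%:Z + k%:Z.
Proof.
elim: k => [|k IH] h; first by rewrite time_upper0; lia.
have := IH (ltnW h); have := time_upperS h; lia.
Qed.

Lemma upperE : upper n = (((lower n).1 + (se_size F)%:Z), ((lower n).2 + (se_size F)%:Z)).
Proof.
have -> : upper n = endpoint (endpoint origin (NE_stair (nw_size F))) (end_path F).
  by rewrite /upper /vertex take_oversize ?size_tuple.
have -> : lower n = endpoint origin (start_path F).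
  by rewrite /lower /vertex take_oversize ?size_tuple.
by rewrite -shape_closed endpoint_EN.
Qed.

Lemma time_lower_upper k : (k <= n)%N -> time (lower k) <= time (upper k).
Proof.
move=> h; have [->|k0] := posnP k; first by rewrite time_lower0 time_upper0; lia.
have [->|kn] := eqVneq k n; first by rewrite upperE /time /=; lia.
have /andP[] := @end_path_above _ F k ltac:(lia).
rewrite -/(upper k) -/(lower k) /time; lia.
Qed.

Lemma time_lower_upper_lt k : (0 < k < n)%N -> time (lower k) + 2 <= time (upper k).
Proof.
by move=> /(@end_path_above _ F)/andP[]; rewrite -/(upper k) -/(lower k) /time; lia.
Qed.

Let lo_time (k : nat) : nat := `|time (lower k) + n.*2%:Z|.
Let hi_time (k : nat) : nat := `|time (upper k) + n.*2%:Z|.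

Lemma lo_timeE k : (k <= n)%N -> (lo_time k)%:Z = time (lower k) + n.*2%:Z.
Proof. by move=> h; have := time_lower_ge h; rewrite /lo_time; lia. Qed.

Lemma hi_timeE k : (k <= n)%N -> (hi_time k)%:Z = time (upper k) + n.*2%:Z.
Proof. by move=> h; have := time_upper_bounds h; rewrite /hi_time; lia. Qed.

Lemma lo_time_step k : (k < n)%N ->
  lo_time k.+1 = (lo_time k).+1 \/ lo_time k = (lo_time k.+1).+1.
Proof.
by move=> h; have := time_lowerS h; have := lo_timeE h; have := lo_timeE (ltnW h); lia.
Qed.

Lemma hi_time_step k : (k < n)%N ->
  hi_time k.+1 = (hi_time k).+1 \/ hi_time k = (hi_time k.+1).+1.
Proof.
by move=> h; have := time_upperS h; have := hi_timeE h; have := hi_timeE (ltnW h); lia.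
Qed.

Lemma lo_time_odd k : (k <= n)%N -> ~~ odd (k + lo_time k + 0).
Proof.
by move=> h; have := diag_lower h; have := lo_timeE h; rewrite /diag /time; lia.
Qed.

Lemma hi_time_odd k : (k <= n)%N -> ~~ odd (k + hi_time k + 0).
Proof.
by move=> h; have := diag_upper h; have := hi_timeE h; rewrite /diag /time; lia.
Qed.

Lemma lo_hi_time k : (k <= n)%N -> (lo_time k <= hi_time k)%N.
Proof.
by move=> h; have := time_lower_upper h; have := lo_timeE h; have := hi_timeE h; lia.
Qed.

Let last_time : nat := ((nw_size F).*2 + n.*2 + n)%N.

Lemma hi_time_last k : (k <= n)%N -> (hi_time k <= last_time)%N.
Proof.
by move=> h; have := hi_timeE h; have := time_upper_bounds h; rewrite /last_time; lia.
Qed.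

Definition shape_net : net :=
  Net lo_time_step hi_time_step lo_time_odd hi_time_odd lo_hi_time hi_time_last.

Local Notation N := shape_net.

(** An edge is dated by its lower-left end, the earlier end of a south or east step. *)
Definition entry_time (d : nat) : nat := minn (lo N d.-1) (lo N d).
Definition exit_time (d : nat) : nat := minn (hi N d.-1) (hi N d).

Local Notation clock := (clock n).

Lemma entry_edgeE (i : 'I_n) :
  level (entry_edge F i) = i.+1%:Z /\ clock (entry_edge F i).2 = (entry_time i.+1)%:Z.
Proof.
have hi := ltn_ord i.
have se : is_SE (tnth (start_path F) i).
  by rewrite (tnth_nth South); apply: nth_SE; apply: start_path_SE.
rewrite /entry_edge level_step // -/(lower i) diag_lower ?(ltnW hi) //; split; first lia.
rewrite /clock time_step // (tnth_nth South) -lowerS // /entry_time /=.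
have := lo_timeE hi; have := lo_timeE (ltnW hi); lia.
Qed.

Lemma exit_edgeE (i : 'I_n) :
  level (exit_edge F i) = i.+1%:Z /\ clock (exit_edge F i).2 = (exit_time i.+1)%:Z.
Proof.
have hi := ltn_ord i.
have se : is_SE (tnth (end_path F) i).
  by rewrite (tnth_nth South); apply: nth_SE; apply: end_path_SE.
rewrite /exit_edge level_step // -/(upper i) diag_upper ?(ltnW hi) //; split; first lia.
rewrite /clock time_step // (tnth_nth South) -upperS // /exit_time /=.
have := hi_timeE hi; have := hi_timeE (ltnW hi); lia.
Qed.

Hypothesis hn : (1 < n)%N.

(** As [1 < n], one end of the step is an interior vertex, where the two paths are at least two time
    units apart; this absorbs the possible difference between the two ends of a step. *)
Lemma entry_exit_time d : (0 < d <= n)%N -> (entry_time d < exit_time d)%N.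
Proof.
move=> h; rewrite /entry_time /exit_time /=.
have h1 : (d.-1 < n)%N by lia.
have h2 : (d.-1 <= n)%N by lia.
have h3 : (d <= n)%N by lia.
have := lo_time_step h1; have := hi_time_step h1; rewrite prednK; last lia.
have := lo_hi_time h2; have := lo_hi_time h3.
have [k0|k1] := leqP d 1.
  have := @time_lower_upper_lt d ltac:(lia).
  have := lo_timeE h3; have := hi_timeE h3; lia.
have := @time_lower_upper_lt d.-1 ltac:(lia).
have := lo_timeE h2; have := hi_timeE h2; lia.
Qed.

Lemma boundary_level e : boundary F e ->
  0 <= level e <= n.+1%:Z.
Proof.
rewrite shape_boundary !mem_cat => /or4P[].
- move=> /mem_path_edges[i]; rewrite size_tuple => hi ->.
  rewrite level_step ?nth_SE ?start_path_SE // -/(lower i) diag_lower ?(ltnW hi) //; lia.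
- move=> /level_NE->; rewrite /diag /=; lia.
- move=> /mem_path_edges[i]; rewrite size_tuple => hi ->.
  rewrite level_step ?nth_SE ?end_path_SE // -/(upper i) diag_upper ?(ltnW hi) //; lia.
- move=> /level_EN->.
  have -> : endpoint origin (start_path F) = lower n.
    by rewrite /lower /vertex take_oversize ?size_tuple.
  rewrite diag_lower //; lia.
Qed.

(** The stairs run at levels [0] and [n + 1], so at the other levels the boundary consists of one
    entry step and one exit step. *)
Lemma boundary_time e (d : nat) : (0 < d <= n)%N -> level e = d%:Z ->
  boundary F e = (clock e.2 == (entry_time d)%:Z) || (clock e.2 == (exit_time d)%:Z).
Proof.
move=> hd le.
have d1 : (d.-1 < n)%N by lia.
have dE : d.-1.+1 = d by lia.
have [en1 en2] := entry_edgeE (Ordinal d1); have [ex1 ex2] := exit_edgeE (Ordinal d1).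
rewrite /= dE in en1 en2 ex1 ex2.
rewrite shape_boundary !mem_cat; apply/or4P/orP.
- case.
  + move=> /mem_path_edges[i]; rewrite size_tuple => hi eE; left; apply/eqP.
    have ee : e = entry_edge F (Ordinal hi) by rewrite eE /entry_edge (tnth_nth South).
    have [l1 l2] := entry_edgeE (Ordinal hi); rewrite -ee le /= in l1 l2.
    by rewrite l2; have -> : d = i.+1 by lia.
  + by move=> /level_NE; rewrite le /diag /=; lia.
  + move=> /mem_path_edges[i]; rewrite size_tuple => hi eE; right; apply/eqP.
    have ee : e = exit_edge F (Ordinal hi) by rewrite eE /exit_edge (tnth_nth South).
    have [l1 l2] := exit_edgeE (Ordinal hi); rewrite -ee le /= in l1 l2.
    by rewrite l2; have -> : d = i.+1 by lia.
  + move=> /level_EN.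
    have -> : endpoint origin (start_path F) = lower n.
      by rewrite /lower /vertex take_oversize ?size_tuple.
    by rewrite diag_lower // le; lia.
- case=> /eqP h; [constructor 1|constructor 3]; apply/mem_path_edges;
    exists d.-1; rewrite ?size_tuple //.
  + have -> : e = entry_edge F (Ordinal d1).
      by apply: edge_eq; [rewrite le en1|move: h en2; rewrite /clock; lia].
    by rewrite /entry_edge (tnth_nth South).
  + have -> : e = exit_edge F (Ordinal d1).
      by apply: edge_eq; [rewrite le ex1|move: h ex2; rewrite /clock; lia].
    by rewrite /exit_edge (tnth_nth South).
Qed.

Lemma boundary_succ e : boundary F (succ_edge e) = ((succ_edge e).2 \in cells F) (+) (e.2 \in cells F).
Proof.
by case: e => [[] [x y]]; rewrite /boundary /succ_edge /west_of /south_of /= addrK.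
Qed.

Lemma cells_bounded : exists B : nat, forall p, p \in cells F -> clock p < B%:Z.
Proof.
exists (\max_(p <- enum_fset (cells F)) `|clock p|%N).+1 => p pF.
have h : (`|clock p| <= \max_(p <- enum_fset (cells F)) `|clock p|)%N.
  exact: (@leq_bigmax_seq _ (enum_fset (cells F)) predT (fun p => `|clock p|%N) p pF isT).
by move: (\max_(_ <- _) _)%N h => B; clear; lia.
Qed.

(** Descending induction along the zigzag, from a time beyond all of the finitely many cells. *)
Lemma in_cells e (d : nat) : (0 < d <= n)%N -> level e = d%:Z ->
  (e.2 \in cells F) = ((entry_time d)%:Z <= clock e.2 < (exit_time d)%:Z).
Proof.
move=> hd le; have [B hB] := cells_bounded.
have ee := entry_exit_time hd.
pose B' := maxn B (exit_time d).
have H m : forall e, level e = d%:Z -> B'%:Z <= clock e.2 + m%:Z ->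
    (e.2 \in cells F) = ((entry_time d)%:Z <= clock e.2 < (exit_time d)%:Z).
  elim: m => [|m IH] {le} e le hm.
    have -> : (clock e.2 < (exit_time d)%:Z) = false by rewrite /B' in hm; lia.
    rewrite andbF; apply/negP=> /hB; rewrite /B' in hm; lia.
  have h1 := @boundary_succ e; rewrite (boundary_time hd) ?level_succ // in h1.
  rewrite IH ?level_succ // ?clock_succ in h1; last lia.
  by clear -h1 ee; move: h1; case: (e.2 \in cells F); lia.
by apply: (H `|B'%:Z - clock e.2|%N) => //; lia.
Qed.

Lemma out_of_levels e : (level e < 0) || (n.+1%:Z < level e) -> e.2 \notin cells F.
Proof.
move=> le; have [B hB] := cells_bounded.
have H m : forall e, (level e < 0) || (n.+1%:Z < level e) -> B%:Z <= clock e.2 + m%:Z ->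
    e.2 \notin cells F.
  elim: m => [|m IH] {le} e le hm; first by apply/negP=> /hB; lia.
  have h1 := @boundary_succ e.
  have nb : boundary F (succ_edge e) = false.
    by apply/negP=> /boundary_level; rewrite level_succ; lia.
  have := IH (succ_edge e); rewrite level_succ clock_succ => /(_ le ltac:(lia)) h2.
  by move: h1; rewrite nb (negbTE h2); case: (e.2 \in cells F).
by apply: (H `|B%:Z - clock e.2|%N) => //; lia.
Qed.

Lemma cells_net (p : point) : p \in cells F ->
  [/\ diag p = `|diag p|%N%:Z, clock p = `|clock p|%N%:Z & cell N `|diag p|%N `|clock p|%N].
Proof.
move=> pF.
have d0 : 0 <= diag p.
  rewrite leNgt; apply/negP=> h; have := @out_of_levels (vedge p).
  by rewrite pF /level /=; move=> /(_ ltac:(lia)).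
have dn : diag p <= n%:Z.
  rewrite leNgt; apply/negP=> h; have := @out_of_levels (hedge p).
  by rewrite pF /level /=; move=> /(_ ltac:(lia)).
have par : exists t : int, clock p = diag p + t + t.
  by exists (p.2 + n%:Z); rewrite /clock /time /diag; lia.
case: par => t ht.
(* On diagonal 0 the west side has level 0, which carries no pipe; the south side, at level 1, is
   used instead. *)
have [k0|k0] := posnP `|diag p|%N.
  have := @in_cells (hedge p) 1 ltac:(lia); rewrite /level /= pF => /(_ ltac:(lia)).
  rewrite /entry_time /exit_time /= => /esym/andP[h1 h2].
  have s1 := @lo_time_step 0 ltac:(lia); have s2 := @hi_time_step 0 ltac:(lia).
  have o1 := @lo_time_odd 0 isT; have o2 := @hi_time_odd 0 isT.
  split; try lia; rewrite /cell k0 /=; apply/and3P; split; lia.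
have hd : (0 < `|diag p|%N <= n)%N by lia.
have := @in_cells (vedge p) `|diag p|%N hd; rewrite /level /= pF => /(_ ltac:(lia)).
rewrite /entry_time /exit_time => /esym/andP[h1 h2].
move: hd h1 h2 d0 dn ht; set k := `|diag p|%N => hd h1 h2 d0 dn ht.
have kE : diag p = k%:Z by rewrite /k; lia.
have s1 := @lo_time_step k.-1 ltac:(lia); have s2 := @hi_time_step k.-1 ltac:(lia).
have o1 := @lo_time_odd k ltac:(lia); have o2 := @hi_time_odd k ltac:(lia).
rewrite prednK in s1 s2; last (clear -hd; lia).
rewrite kE in ht; clear d0 dn k0.
split=> //; first by clear -h1; lia.
rewrite /cell /= in h1 h2 *; apply/and4P; split; lia.
Qed.

Lemma net_cells (p : point) k j : diag p = k%:Z -> clock p = j%:Z -> cell N k j -> p \in cells F.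
Proof.
move=> hk hj /and4P[/= kn o h1 h2].
have [k0|k0] := posnP k.
  rewrite (@in_cells (hedge p) 1) ?/level /= ?hk ?k0 //; last by lia.
  rewrite /entry_time /exit_time /= hj.
  have s1 := @lo_time_step 0 ltac:(lia); have s2 := @hi_time_step 0 ltac:(lia).
  rewrite k0 in h1 h2 o; have o2 := @hi_time_odd 0 isT.
  lia.
rewrite (@in_cells (vedge p) k) ?/level /= ?hk ?k0 //; last by lia.
rewrite /entry_time /exit_time /= hj.
have s1 := @lo_time_step k.-1 ltac:(lia); have s2 := @hi_time_step k.-1 ltac:(lia).
have o2 := @hi_time_odd k ltac:(lia); rewrite prednK in s1 s2; last lia.
lia.
Qed.

Lemma cell_point k j : cell N k j ->
  exists2 c : F, diag (val c) = k%:Z & clock (val c) = j%:Z.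
Proof.
move=> h; have /and4P[/= kn o h1 _] := h.
have := lo_timeE kn; have := time_lower_ge kn => l1 l2.
have [t ht] : exists t, j = (k + t.*2)%N by exists ((j - k)./2); lia.
pose p : point := (k%:Z + t%:Z - n%:Z, t%:Z - n%:Z).
have dp : diag p = k%:Z by rewrite /diag /p /=; lia.
have cp : clock p = j%:Z by rewrite /clock /time /p /=; lia.
by exists [` net_cells dp cp h]%fset.
Qed.

Lemma cell_levels k j : cell N k j ->
  ((0 < k)%N -> (entry_time k <= j < exit_time k)%N) /\
  ((k < n)%N -> (entry_time k.+1 <= j < exit_time k.+1)%N).
Proof.
move=> /and4P[/= kn o h1 h2]; rewrite /entry_time /exit_time /=.
have o1 := hi_time_odd kn.
split=> hk.
  have := @hi_time_step k.-1 ltac:(lia); rewrite prednK //; lia.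
have := @hi_time_step k hk; lia.
Qed.

End Shape.

Lemma side_level (c : point) :
  ((level (west_side c) = diag c) * (level (south_side c) = (diag c + 1)%R) *
   (level (east_side c) = (diag c + 1)%R) * (level (north_side c) = diag c))%type.
Proof. by split; [split; [split|]|]; rewrite /level /diag /=; lia. Qed.

Lemma side_clock n (c : point) :
  ((clock n (west_side c).2 = clock n c) * (clock n (south_side c).2 = clock n c) *
   (clock n (east_side c).2 = (clock n c + 1)%R) * (clock n (north_side c).2 = (clock n c + 1)%R))%type.
Proof. by split; [split; [split|]|]; rewrite /clock /time /=; lia. Qed.

Lemma side_diag (c : point) :
  ((diag (east_side c).2 = (diag c + 1)%R) * (diag (north_side c).2 = (diag c - 1)%R))%type.
Proof. by split; rewrite /diag /=; lia. Qed.

Lemma clock_parity n (c : point) : exists t : int, clock n c = diag c + t + t.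
Proof. by exists (c.2 + n%:Z); rewrite /clock /time /diag; lia. Qed.

Lemma succ_edge_surj e : exists e0, succ_edge e0 = e.
Proof.
case: e => [[] [x y]]; [exists (vedge (x, y - 1))|exists (hedge (x - 1, y))];
  by rewrite /succ_edge /north_of /east_of /= subrK.
Qed.

(** * Pipes in the grid and their levels *)

Section Pipes.

Variables (n : nat) (hn : (1 < n)%N) (F : alternating_shape n).
Local Notation N := (shape_net F).
Local Notation M := (horizon N).
Local Notation clk := (clock n).

Section Filling.

Variable P : filling F.

Definition is_cross (t : tile) : bool := if t is Cross then true else false.

Definition tiling (k j : nat) : bool :=
  [exists c : F, [&& diag (val c) == k%:Z, clk (val c) == j%:Z & is_cross (P c)]].

Local Notation lev := (lev N tiling).
Local Notation C := (crossing N tiling).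

Lemma cell_inj (c c' : F) : diag (val c) = diag (val c') -> clk (val c) = clk (val c') -> c = c'.
Proof. by move=> h1 h2; apply: val_inj; apply: point_eq => //; move: h2; rewrite /clock; lia. Qed.

Lemma tilingE (c : F) k j : diag (val c) = k%:Z -> clk (val c) = j%:Z ->
  tiling k j = is_cross (P c).
Proof.
move=> hk hj; apply/existsP/idP => [[c' /and3P[/eqP h1 /eqP h2 h3]]|h].
  by rewrite (@cell_inj c c') ?h1 ?h2.
by exists c; rewrite hk hj !eqxx.
Qed.

Lemma shape_cell (c : F) : exists k j, [/\ diag (val c) = k%:Z, clk (val c) = j%:Z & cell N k j].
Proof. by have [h1 h2 h3] := cells_net hn (valP c); do 2![eexists]; split; eauto. Qed.

Lemma crossingE (c : F) k j : diag (val c) = k%:Z -> clk (val c) = j%:Z -> cell N k j ->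
  C k j = [&& is_cross (P c), (0 < k)%N & (k < n)%N].
Proof. by move=> h1 h2 h3; rewrite /crossing h3 (tilingE h1 h2). Qed.

(* A crossing on the northwest or southeast stair would stop a pipe. *)
Definition contact_on_stairs : Prop :=
  forall c : F, diag (val c) = 0 \/ diag (val c) = n%:Z -> P c = Contact.

(** As [crossing] disregards the stairs, [lev] goes on where the actual pipe is sent out of the
    shape; these are the times at which the two part. *)
Definition stopped (a j : nat) : Prop := exists c : F,
  [/\ P c = Cross, clk (val c) = j%:Z &
      (diag (val c) = 0 /\ lev a j = 1%N) \/ (diag (val c) = n%:Z /\ lev a j = n)].

(** In the second alternative the pipe has just been sent across a stair, and no cell continues
    it. *)
Lemma on_pipe_level (a : 'I_n) e : on_pipe P a e ->
  (exists d s : nat, [/\ (0 < d <= n)%N, level e = d%:Z /\ clk e.2 = s%:Z,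
     (entry_time F d <= s <= exit_time F d)%N, lev a s = d &
     forall j, (entry_time F a.+1 <= j < s)%N -> ~ stopped a j]) \/
  [/\ ~~ (0 < level e <= n%:Z), e.2 \notin cells F & ~ contact_on_stairs].
Proof.
move=> h0; have h := Operators_Properties.clos_rt_rtn1 _ _ _ _ h0; elim: h {h0} => [|e1 e2 [c hc] _ IH].
  have [h1 h2] := entry_edgeE F a; left; exists a.+1, (entry_time F a.+1).
  have ha : (0 < a.+1 <= n)%N by rewrite /= ltn_ord.
  split=> //; last by move=> j; clear; lia.
    by rewrite leqnn ltnW // entry_exit_time.
  by apply/eqP; rewrite (@lev_before N tiling a.+1 (entry_time F a.+1) ha (leqnn _) a).
have [k [s [hk hs kc]]] := shape_cell c.
have cF : val c \in cells F := valP c.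
have e1c : e1.2 = val c.
  by case: (P c) hc => -[] [-> _].
case: IH => [[d [s' [hd [l1 l2] hes hl ns]]]|[_ h _]]; last by rewrite e1c cF in h.
have es : s' = s by move: l2; rewrite e1c hs; clear; lia.
subst s'.
have /and4P[/= kn o _ _] := kc.
have [cl1 cl2] := cell_levels hn kc.
have cE := crossingE hk hs kc.
have nstop : ~ stopped a s -> forall j, (entry_time F a.+1 <= j < s.+1)%N -> ~ stopped a j.
  move=> h j hj; have [->//|ne] := eqVneq j s.
  by apply: ns; move: hj ne; clear; lia.
have par (c' : F) : clk (val c') = s%:Z -> diag (val c') = diag (val c) \/
    [/\ diag (val c') <> diag (val c), diag (val c') <> diag (val c) + 1 &
        diag (val c') + 1 <> diag (val c)].
  have [t1 ->] := clock_parity n (val c'); have [t2 t2E] := clock_parity n (val c).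
  move: t2E; rewrite hk hs => t2E t1E.
  by have [->|/eqP ne] := eqVneq (diag (val c')) k%:Z;
    [left|right; split; move: ne t2E t1E; clear; lia].
case Pc : (P c) hc => -[] [e1E e2E]; rewrite Pc /= in cE.
- have dk : d = k by move: l1; rewrite e1E side_level hk; clear; lia.
  rewrite dk in hd hl hes; clear l1 dk.
  have [ekn|nekn] := eqVneq k n.
    right; split.
    + by rewrite e2E side_level hk ekn; clear; lia.
    + rewrite e2E; apply/negP=> /(cells_net hn)[h1 _ /and4P[h2 _ _ _]].
      by move: h1 h2; rewrite side_diag hk ekn /=; clear; lia.
    + by move=> g; have := g c; rewrite Pc hk ekn => /(_ (or_intror erefl)).
  have kn' : (k < n)%N by move: kn nekn; clear; lia.
  have cc : C k s by rewrite cE; move: hd kn'; clear; lia.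
  left; exists k.+1, s.+1; split.
  + by move: kn'; clear; lia.
  + by rewrite e2E side_level side_clock hk hs; clear; split; lia.
  + by have := cl2 kn'; clear; lia.
  + exact: lev_west hl cc.
  + apply: nstop => -[c' [_ h1 h2]]; case: (par _ h1) h2; rewrite hk hl.
      by move=> ->; move: hd nekn; clear; lia.
    by case=> n1 n2 n3; move: n1 n2 n3 hd nekn; clear; lia.
- have dk : d = k.+1 by move: l1; rewrite e1E side_level hk; clear; lia.
  rewrite dk in hd hl hes; clear l1 dk.
  have [ek0|nek0] := posnP k.
    right; split.
    + by rewrite e2E side_level hk ek0; clear; lia.
    + rewrite e2E; apply/negP=> /(cells_net hn)[h1 _ _].
      by move: h1; rewrite side_diag hk ek0; clear; lia.
    + by move=> g; have := g c; rewrite Pc hk ek0 => /(_ (or_introl erefl)).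
  have kn' : (k < n)%N by move: hd; clear; lia.
  have cc : C k s by rewrite cE nek0 kn'.
  left; exists k, s.+1; split.
  + by move: kn nek0; clear; lia.
  + by rewrite e2E side_level side_clock hk hs; clear; split; lia.
  + by have := cl1 nek0; clear; lia.
  + exact: lev_south hl cc.
  + apply: nstop => -[c' [_ h1 h2]]; case: (par _ h1) h2; rewrite hk hl.
      by move=> ->; move: hd nek0; clear; lia.
    by case=> n1 n2 n3; move: n1 n2 n3 hd nek0; clear; lia.
- have dk : d = k by move: l1; rewrite e1E side_level hk; clear; lia.
  rewrite dk in hd hl hes; clear l1 dk.
  have k0 : (0 < k)%N by move: hd; clear; lia.
  left; exists k, s.+1; split=> //.
  + by rewrite e2E side_level side_clock hk hs; clear; split; lia.
  + by have := cl1 k0; clear; lia.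
  + by apply: lev_west_contact hl _ o; rewrite cE.
  + apply: nstop => -[c' [Pc' h1 h2]]; case: (par _ h1) => h3.
      by rewrite (@cell_inj c' c) ?Pc ?h1 ?hs // in Pc'.
    by case: h3 => n1 n2 n3; move: h2 n1 n2 n3; rewrite hk hl; move: hd; clear; lia.
- have dk : d = k.+1 by move: l1; rewrite e1E side_level hk; clear; lia.
  rewrite dk in hd hl hes; clear l1 dk.
  have k0 : (k < n)%N by move: hd; clear; lia.
  left; exists k.+1, s.+1; split=> //.
  + by rewrite e2E side_level side_clock hk hs; clear; split; lia.
  + by have := cl2 k0; clear; lia.
  + by apply: lev_south_contact hl _ o; rewrite cE.
  + apply: nstop => -[c' [Pc' h1 h2]]; case: (par _ h1) => h3.
      by rewrite (@cell_inj c' c) ?Pc ?h1 ?hs // in Pc'.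
    by case: h3 => n1 n2 n3; move: h2 n1 n2 n3; rewrite hk hl; move: hd; clear; lia.
Qed.

(** A crossing on a stair would stop the pipe [a] that has the extreme level at that time. But this
    time lies between the entry and the exit of [a], since before and after them its level is
    outside its active period. *)
Lemma exit_contact_on_stairs (w : 'S_n) : exit_permutation P w -> contact_on_stairs.
Proof.
move=> ex c dc; case Pc : (P c) => //; exfalso.
have [k [s [hk hs kc]]] := shape_cell c.
have [cl1 cl2] := cell_levels hn kc.
have [d [hd hds hkd]] : exists d : nat, [/\ (0 < d <= n)%N,
    (entry_time F d <= s < exit_time F d)%N & (k = 0%N /\ d = 1%N) \/ (k = n /\ d = n)].
  case: dc; rewrite hk => e.
    by exists 1%N; have k0 : k = 0%N by [lia]; rewrite k0 in cl2; split; [lia|apply: cl2; lia|left].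
  have kn : k = n by lia.
  by exists n; rewrite kn in cl1; split; [lia|apply: cl1; lia|right].
have [a0 ha0] := @lev_surj N tiling d s ltac:(lia).
have an : (a0 < n)%N by have := lev_le_width N tiling a0 s; rewrite ha0 /=; lia.
pose a := Ordinal an; pose i := (w^-1)%g a.
have := ex i; rewrite permKV => /on_pipe_level.
have [e1 e2] := exit_edgeE F i.
case=> [[d' [s' [hd' [l1 l2] hes hl ns]]]|[h _ _]]; last first.
  by move: h; rewrite e1; have := ltn_ord i; clear; lia.
have ed : d' = i.+1 by move: l1; rewrite e1; clear; lia.
have es : s' = exit_time F d' by move: l2; rewrite e2 ed; clear; lia.
apply: (ns s); last first.
  by exists c; split=> //; rewrite hk /= ha0; case: hkd => -[-> ->]; [left|right].
apply/andP; split; rewrite leqNgt; apply/negP=> hs'.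
  have han : (0 < a.+1 <= n)%N by rewrite /= an.
  have := @lev_before N tiling a.+1 s han (ltnW hs') a => -[_]; rewrite eqxx ha0 => /eqP da.
  by move: hds hs'; rewrite da; clear; lia.
have aft : (minn (hi N d'.-1) (hi N d') <= s' <= s)%N.
  by rewrite -/(exit_time F d') es leqnn -es; move: hs'; clear; lia.
have := @lev_after N tiling d' s' s hd' aft a => -[_]; rewrite hl eqxx ha0 => /eqP dd.
by move: hds hs'; rewrite dd es; clear; lia.
Qed.

Hypothesis stairs : contact_on_stairs.

Lemma on_pipe_lev (a : 'I_n) e : on_pipe P a e ->
  exists d s : nat, [/\ (0 < d <= n)%N, level e = d%:Z, clk e.2 = s%:Z & lev a s = d].
Proof.
case/on_pipe_level=> [[d [s [h1 [h2 h3] _ h4 _]]]|[_ _ []//]].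
by exists d, s.
Qed.

Lemma entry_on_pipe (a : 'I_n) e (d : nat) : (0 < d <= n)%N -> level e = d%:Z ->
  clk e.2 = (entry_time F d)%:Z -> lev a (entry_time F d) = d -> on_pipe P a e.
Proof.
move=> hd l1 l2 hl; have [h1 h2] := entry_edgeE F a.
have da : a.+1 = d by apply/eqP; rewrite -(@lev_before N tiling d _ hd (leqnn _) a) hl.
have -> : e = entry_edge F a; last exact: rt_refl.
apply: edge_eq; first by rewrite l1 h1 da.
by move: l2; rewrite -da -h2 /clock; clear; lia.
Qed.

Lemma lev_on_pipe s : forall (a : 'I_n) e (d : nat), (0 < d <= n)%N ->
    level e = d%:Z -> clk e.2 = s%:Z -> (entry_time F d <= s <= exit_time F d)%N ->
    lev a s = d -> on_pipe P a e.
Proof.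
elim: s => [|s IH] a e d hd l1 l2 hs hl.
  have et : entry_time F d = 0%N by move: hs; clear; lia.
  by apply: (entry_on_pipe hd l1); rewrite et.
have [et|nt] := eqVneq (entry_time F d) s.+1.
  by apply: (entry_on_pipe hd l1); rewrite et.
have hs1 : (entry_time F d <= s < exit_time F d)%N by move: hs nt; clear; lia.
have [e0 se0] := succ_edge_surj e.
have l0 : level e0 = d%:Z by rewrite -level_succ se0.
have c0 : clk e0.2 = s%:Z by have := clock_succ n e0; rewrite se0 l2; clear; lia.
have e0F : e0.2 \in cells F by rewrite (in_cells F hn hd l0) c0; move: hs1; clear; lia.
pose c : F := [` e0F]%fset.
have cE : val c = e0.2 by [].
have [k [s' [hk hs' kc]]] := shape_cell c.
have es : s' = s by move: hs'; rewrite cE c0; clear; lia.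
rewrite es in hs' kc.
have [cl1 cl2] := cell_levels hn kc.
have /and4P[/= kn o _ _] := kc.
have crE := crossingE hk hs' kc.
(* The previous edge of the pipe: at a contact the pipe keeps its level and comes from [e0]; at a
   crossing it comes from the other incoming side of the cell. *)
apply: (rt_trans _ _ _ (if P c is Cross then
  if e0.1 then west_side (val c) else south_side (val c) else e0)).
  case Pc : (P c) crE => /= crE.
    have cc : C k s.
      rewrite crE; apply/negPn/negP=> nk; have := stairs (c := c); rewrite Pc hk.
      suff : k%:Z = 0 \/ k%:Z = n%:Z by move=> h1' /(_ h1').
      by move: nk kn; clear; lia.
    have [_ k0 kn'] := crossing_cell cc; rewrite /= in kn'.
    case he : e0.1.
      have dk : d = k.+1 by move: l0 hk; rewrite /level he cE /=; clear; lia.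
      apply: (IH a _ k); rewrite ?side_level ?side_clock ?hk ?hs' //.
      - by move: k0 kn'; clear; lia.
      - by have := cl1 k0; clear; lia.
      - by apply: lev_west_prev cc; rewrite -dk.
    have dk : d = k by move: l0 hk; rewrite /level he cE /=; clear; lia.
    apply: (IH a _ k.+1); rewrite ?side_level ?side_clock ?hk ?hs' //.
    - by clear; lia.
    - by have := cl2 kn'; clear; lia.
    - by apply: lev_south_prev cc; rewrite -dk.
  have [p1 p2] := @lev_contact_prev N tiling k s a ltac:(by rewrite crE) o.
  apply: (IH a _ d) => //; first by move: hs1; clear; lia.
  case he : e0.1 l0 => l0.
    have dk : d = k.+1 by move: l0 hk; rewrite /level he cE /=; clear; lia.
    by rewrite dk; apply: p2; rewrite -dk.
  have dk : d = k by move: l0 hk; rewrite /level he cE /=; clear; lia.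
  by rewrite dk; apply: p1; rewrite -dk.
apply: rt_step; exists c; rewrite -se0 cE /succ_edge.
case: (P c); case: (e0) => [[] p] /=.
- by left.
- by right.
- by right.
- by left.
Qed.

Lemma west_pipe (c : F) k j (a : 'I_n) : diag (val c) = k%:Z -> clk (val c) = j%:Z ->
  on_pipe P a (west_side (val c)) <-> lev a j = k.
Proof.
move=> hk hj; split.
  move=> /on_pipe_lev[d [s [_]]]; rewrite side_level side_clock hk hj.
  by move=> e1 e2; have -> : d = k by [lia]; have -> : s = j by lia.
move=> hl; have k0 : (0 < k)%N by rewrite -hl lev_gt0.
have [k' [j' [hk' hj' kc]]] := shape_cell c.
have ek : k' = k by lia.
have ej : j' = j by lia.
rewrite ek ej in kc; have [cl1 _] := cell_levels hn kc; have /and4P[/= kn _ _ _] := kc.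
apply: (lev_on_pipe (s := j) (d := k)); rewrite ?side_level ?side_clock //.
  by rewrite k0.
by have := cl1 k0; clear; lia.
Qed.

Lemma south_pipe (c : F) k j (a : 'I_n) : diag (val c) = k%:Z -> clk (val c) = j%:Z ->
  on_pipe P a (south_side (val c)) <-> lev a j = k.+1.
Proof.
move=> hk hj; split.
  move=> /on_pipe_lev[d [s [_]]]; rewrite side_level side_clock hk hj.
  by move=> e1 e2; have -> : d = k.+1 by [lia]; have -> : s = j by lia.
move=> hl.
have k0 : (k < n)%N by rewrite -[n]/(width N) -hl lev_le_width.
have [k' [j' [hk' hj' kc]]] := shape_cell c.
have ek : k' = k by lia.
have ej : j' = j by lia.
rewrite ek ej in kc; have [_ cl2] := cell_levels hn kc.
apply: (lev_on_pipe (s := j) (d := k.+1)); rewrite ?side_level ?side_clock ?hk //.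
  by lia.
by have := cl2 k0; clear; lia.
Qed.

Lemma contact_arcE (a b : 'I_n) : contact_arc P a b <-> exists j, contact N tiling a b j.
Proof.
split=> [[c [Pc wa sb]]|[j /and4P[h1 h2 /eqP h3 h4]]].
  have [k [j [hk hj kc]]] := shape_cell c.
  have la : lev a j = k by apply/(west_pipe a hk hj).
  have lb : lev b j = k.+1 by apply/(south_pipe b hk hj).
  exists j; apply: (contactE la lb) => //.
    by rewrite -lb lev_le_width.
  by rewrite (crossingE hk hj kc) Pc.
have [c hk hj] := cell_point hn h2.
exists c; split.
- move: h4; rewrite (crossingE hk hj h2) h1 lev_gt0 !andbT.
  by case: (P c).
- exact/(west_pipe a hk hj).
- by apply/(south_pipe b hk hj); rewrite h3.
Qed.

Lemma cross_atE (a b : 'I_n) (c : F) k j : diag (val c) = k%:Z -> clk (val c) = j%:Z ->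
  cell N k j -> cross_at P a b c <->
  C k j /\ ((lev a j = k /\ lev b j = k.+1) \/ (lev b j = k /\ lev a j = k.+1)).
Proof.
move=> hk hj kc; have W a' := west_pipe a' hk hj; have S a' := south_pipe a' hk hj.
have G a' b' : lev a' j = k -> lev b' j = k.+1 -> (b' < n)%N -> (0 < k)%N && (k < n)%N.
  by move=> h1 h2 bn; rewrite -{1}h1 lev_gt0 -[n]/(width N) -h2 lev_le_width.
rewrite (crossingE hk hj kc); split=> [[Pc h]|[/and3P[Pc _ _] h]].
  have h' : (lev a j = k /\ lev b j = k.+1) \/ (lev b j = k /\ lev a j = k.+1).
    by case: h => -[/W h1 /S h2]; [left|right].
  split=> //; rewrite Pc /=; case: h' => -[h1 h2]; exact: G h1 h2 (ltn_ord _).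
split; first by case: (P c) Pc.
by case: h => -[/W h1 /S h2]; [left|right].
Qed.

(** A larger label coming from the west reveals an earlier crossing of the pair, as the pipes start
    in increasing order. Conversely, after crossing with the smaller label from the west, a pair
    stays inverted and cannot cross so again. *)
Lemma reducedE : reduced P <-> reduced_tiling N tiling.
Proof.
split=> red.
  move=> p q j cc e; have [kc k0 kn] := crossing_cell cc.
  have pn : (p < n)%N by rewrite -[n]/(width N) -(lev_le_width N tiling p j) ltnW.
  have qn : (q < n)%N by rewrite -[n]/(width N) -(lev_le_width N tiling q j) e.
  have pq : p <> q by move=> pq; move: e; rewrite pq; clear; lia.
  rewrite ltnNge; apply/negP=> qp.
  have [||i [ij ci ei]] := @lev_crossing N tiling q p 0 j isT.
  - by rewrite /=; move: qp pq; clear; lia.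
  - by rewrite e.
  have [ki _ _] := crossing_cell ci.
  have [c hk hj] := cell_point hn kc; have [c' hk' hj'] := cell_point hn ki.
  have cc' : c = c'.
    apply: (red (Ordinal pn) (Ordinal qn)); first by case.
      by apply/(cross_atE _ _ hk hj kc); split=> //; left.
    by apply/(cross_atE _ _ hk' hj' ki); split=> //; right.
  by move: ij hj hj'; rewrite cc' => + -> ; clear; lia.
have key (a b : 'I_n) (c d : F) k j k' j' : a <> b ->
    diag (val c) = k%:Z -> clk (val c) = j%:Z -> cell N k j ->
    diag (val d) = k'%:Z -> clk (val d) = j'%:Z -> cell N k' j' ->
    cross_at P a b c -> cross_at P a b d -> ~ (j < j')%N.
  move=> ab hk hj kc hk' hj' kd /(cross_atE _ _ hk hj kc)[cc h] /(cross_atE _ _ hk' hj' kd)[cd h'] jj.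
  have H (p q p' q' : nat) : (p = p' /\ q = q') \/ (p = q' /\ q = p') ->
      lev p j = k -> lev q j = k.+1 -> lev p' j' = k' -> lev q' j' = k'.+1 -> False.
    move=> e h1 h2 h3 h4.
    have pq : (p < q)%N by apply: (red p q j); rewrite h1.
    have pq' : (p' < q')%N by apply: (red p' q' j'); rewrite h3.
    case: e => -[ep eq]; last by move: pq pq'; rewrite ep eq; clear; lia.
    have := reduced_crossed red pq jj.
    rewrite (lev_west h1 cc) (lev_south h2 cc) ep eq h3 h4 => /(_ ltac:(clear; lia)).
    by clear; lia.
  by case: h => -[h1 h2]; case: h' => -[h3 h4]; apply: (H _ _ _ _ _ h1 h2 h3 h4); auto.
move=> a b ab c d hc hd.
have [k [j [hk hj kc]]] := shape_cell c; have [k' [j' [hk' hj' kd]]] := shape_cell d.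
have n1 := key a b c d k j k' j' ab hk hj kc hk' hj' kd hc hd.
have n2 := key a b d c k' j' k j ab hk' hj' kd hk hj kc hd hc.
have ej : j = j' by move: n1 n2; clear; lia.
have := (cross_atE a b hk hj kc).1 hc; have := (cross_atE a b hk' hj' kd).1 hd.
rewrite -ej => -[c1 h1] [c2 h2].
have o1 := crossing_odd c1; have o2 := crossing_odd c2.
apply: cell_inj; rewrite ?hj ?hj' ?ej // hk hk'.
have -> // : k = k' by move: h1 h2 o1 o2; clear; lia.
Qed.

Lemma exit_permutationE (w : 'S_n) :
  exit_permutation P w <-> forall i, (i < n)%N -> lev i M = exit_level (N := N) w i.
Proof.
have fix_ (i : 'I_n) (a : nat) :
    (lev a M == i.+1) = (lev a (exit_time F i.+1) == i.+1).
  have iw : (0 < i.+1 <= n)%N by rewrite /= ltn_ord.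
  have aft : (minn (hi N i.+1.-1) (hi N i.+1) <= exit_time F i.+1 <= M)%N.
    by rewrite leqnn /= /exit_time geq_min hi_horizon // ltnW.
  by rewrite (@lev_after N tiling i.+1 _ _ iw aft).
split=> [ex a an|ex i].
  pose i := (w^-1)%g (Ordinal an).
  have := ex i; rewrite permKV => /on_pipe_lev[d [s [_ ]]].
  have [-> ->] := exit_edgeE F i => e1 e2 hl.
  apply/eqP; rewrite /exit_level (position_lt (N := N) w an) -/(pos w _) fix_.
  by move: e1 e2 => [e1] [e2]; rewrite e2 hl -e1.
have [e1 e2] := exit_edgeE F i; have iw : (0 < i.+1 <= n)%N by rewrite /= ltn_ord.
apply: (lev_on_pipe iw e1 e2).
  by rewrite leqnn andbT ltnW // entry_exit_time.
apply/eqP; rewrite -fix_ ex ?ltn_ord // /exit_level (positionE (N := N)).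
by rewrite /pos permK.
Qed.

End Filling.

End Pipes.

End Grid.

(** * From tilings of the network back to pipe dreams *)

Section PipeEquiv.

Variables (n : nat) (hn : 1 < n) (F : alternating_shape n) (w : 'S_n).
Local Notation N := (shape_net F).
Local Notation D := (weak_interval 1%g w).

Lemma reduced_pipe_dreamE (P : filling F) : reduced_pipe_dream w P <->
  contact_on_stairs P /\ realizes N (exit_level (N := N) w) (tiling P).
Proof.
split=> [[ex red]|[st [red ex]]].
  have st := exit_contact_on_stairs hn ex.
  by split=> //; split; [apply/(reducedE hn st)|apply/(exit_permutationE hn st)].
by split; [apply/(exit_permutationE hn st)|apply/(reducedE hn st)].
Qed.

Definition filling_of (X : nat -> nat -> bool) : filling F :=
  [ffun c : F => if crossing N X `|diag (val c)|%N `|clock n (val c)|%N then Cross else Contact].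

Lemma filling_of_stairs X : contact_on_stairs (filling_of X).
Proof.
move=> c dc; rewrite ffunE; case: ifP => // /crossing_cell[_ h1 h2].
by rewrite -[width N]/n in h2; move: dc h1 h2; clear; lia.
Qed.

Lemma filling_of_crossings X : same_crossings N (tiling (filling_of X)) X.
Proof.
move=> k j; have [kc|nkc] := boolP (cell N k j); last first.
  by rewrite /crossing (negbTE nkc) !andbF.
have [c hk hj] := cell_point hn kc.
rewrite (crossingE hn (filling_of X) hk hj kc) ffunE hk hj /=.
case: ifP => [/crossing_cell[_ -> ->]|] //.
Qed.

(** The noninversion arcs say that every inversion of [x] is one of [w], and the contact arcs give
    compatibility. *)
Lemma fiber_lin (P : filling F) (x : 'S_n) : reduced_pipe_dream w P ->
  lin w P x <-> x \in D /\ fiber (N := N) w x (tiling P).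
Proof.
move=> /reduced_pipe_dreamE[st rP]; split=> [h|[/weak_intervalP xD [_ cP]] a b].
  split.
    apply/weak_intervalP=> a b ab hx; rewrite ltnNge; apply/negP=> hw.
    have := h a b (or_intror _); rewrite /noninversion /inversion ab /= => /(_ ltac:(move: hw; rewrite /pos; clear; lia)).
    by move: hx; rewrite /pos; clear; lia.
  split=> // p q j cpq; have [pn qn] := contact_width cpq.
  rewrite (position_lt (N := N) x pn) (position_lt (N := N) x qn).
  by apply: h; left; apply/(contact_arcE hn st); exists j.
case=> [/(contact_arcE hn st)[j /cP]|]; first by rewrite !(positionE (N := N)).
rewrite /noninversion /inversion => /andP[ab]; rewrite ab /= => hw.
have := xD a b ab; have := @pos_inj _ x a b; rewrite /pos => inj hx.
rewrite ltnNge; apply/negP=> le; move: hw; rewrite hx // ltn_neqAle le andbT.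
by apply/eqP=> e; move: ab; rewrite -inj ?ltnn.
Qed.

Lemma lin_strongly_acyclic (P : filling F) (x : 'S_n) : lin w P x -> strongly_acyclic w P.
Proof.
move=> h a ha.
suff H u v : clos_trans 'I_n (extended_arc w P) u v -> ((x^-1)%g u < (x^-1)%g v)%N.
  by have := H _ _ ha; rewrite ltnn.
elim=> [u' v' /h //|u' v' z _ h1 _ h2]; exact: ltn_trans h1 h2.
Qed.

Lemma pipe_equivE x y : pipe_equiv F w x y <-> same_fiber (N := N) w x y.
Proof.
split=> [[P [[rP _] lx ly]]|[xD yD [X [fx fy]]]].
  have [xD fx] := (fiber_lin x rP).1 lx; have [yD fy] := (fiber_lin y rP).1 ly.
  by split=> //; exists (tiling P).
have S := filling_of_crossings X.
have [[redX exX] _] := fx.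
have red : reduced_tiling N (tiling (filling_of X)).
  by move=> p q j; rewrite !(same_lev S) S; apply: redX.
have rP : reduced_pipe_dream w (filling_of X).
  apply/reduced_pipe_dreamE; split; first exact: filling_of_stairs.
  by split=> // i hi; rewrite (same_lev S) exX.
have L z : z \in D -> fiber (N := N) w z X -> lin w (filling_of X) z.
  move=> zD [[_ ex] cX]; apply/(fiber_lin z rP); split=> //; split.
    by have [_ ] := (reduced_pipe_dreamE _).1 rP.
  by move=> p q j; rewrite (same_contact S); apply: cX.
exists (filling_of X); split; [|exact: L|exact: L].
by split=> //; apply: (lin_strongly_acyclic (L x xD fx)).
Qed.

End PipeEquiv.

Theorem theorem2p4 (n : nat) (hn : (1 < n)%N) (F : alternating_shape n)
    (w : 'S_n) (hw : sortable F w) :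
  lattice_congruence (weak_interval 1%g w) (@weak_le n) (pipe_equiv F w).
Proof.
have [P rP] := hw.
have [_ rX] := (reduced_pipe_dreamE hn w P).1 rP.
have [lat [r s t] cm cj] := @same_fiber_congruence (shape_net F) w (ex_intro _ _ rX).
have E := pipe_equivE hn F w.
split=> //.
- split=> [x xD|x y xD yD /E h|x y z xD yD zD /E h1 /E h2]; apply/E.
  + exact: r.
  + exact: s.
  + exact: (t x y z).
- by move=> x x' y y' m m' *; apply/E; apply: (cm x x' y y') => //; apply/E.
- by move=> x x' y y' m m' *; apply/E; apply: (cj x x' y y') => //; apply/E.
Qed.
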